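(* Let $\alpha\ge 0$ and let $$EQ:\quad a_ky^{(k)}+a_{k-1}y^{(k-1)}+\dots+a_0y=0,\qquad a_j\in\mathbb{C},\ a_k\neq 0,$$ be a linear differential equation with constant coefficients such that all its distinct characteristic roots have distinct real parts. Let $\Pi_\alpha=\{z\in\mathbb{C} : |\operatorname{Im} z|\le\alpha\}$. (1) There exists a finite upper bound $\sharp(EQ,\alpha)$, depending only on $EQ$ and $\alpha$, for the number of zeros, counted with multiplicities, in $\Pi_\alpha$ of all nontrivial solutions of $EQ$. (2) If all roots $\lambda_1,\dots,\lambda_k$ of the characteristic equation of $EQ$ are simple, with $\operatorname{Re}\lambda_1<\operatorname{Re}\lambda_2<\dots<\operatorname{Re}\lambda_k$, then every nontrivial solution of $EQ$ has in $\Pi_\alpha$, counted with multiplicities, at most $$(k-1)^2+\frac{2}{\pi}(k-1)\,\mathcal{L}(EQ)\left[\alpha(\Xi+2)+\Theta\log 4\right]$$ zeros, where $\mathcal{L}(EQ)$ is the length of the shortest polygonal path passing through all $\lambda_j$ and $$\Theta:=\max_{1\le j\le k-1}|\operatorname{Re}(\lambda_j)-\operatorname{Re}(\lambda_{j+1})|^{-1},\qquad \Xi:=\max_{1\le j\le k-1}\left|\frac{\operatorname{Im}\lambda_j-\operatorname{Im}\lambda_{j+1}}{\operatorname{Re}\lambda_j-\operatorname{Re}\lambda_{j+1}}\right|.$$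
   Context: The characteristic roots of $EQ$ are the roots of the polynomial $a_k\lambda^k+a_{k-1}\lambda^{k-1}+\dots+a_0$. Solutions are entire functions of $z\in\mathbb{C}$. *)

(* Defs.v *)
From HB Require Import structures.
From mathcomp Require Import all_boot all_order all_algebra.
From mathcomp Require Import complex.
From mathcomp Require Import all_classical all_reals all_analysis.
Import Order.TTheory GRing.Theory Num.Theory.
Import numFieldNormedType.Exports.
Set Implicit Arguments.
Unset Strict Implicit.
Unset Printing Implicit Defensive.
Local Open Scope ring_scope.
Local Open Scope complex_scope.
Local Open Scope classical_set_scope.

(* The equation a_k y^(k) + ... + a_1 y' + a_0 y = 0 is given by k and by
   a : nat -> R[i], of which only the values a 0, ..., a k matter.
   Derivatives are complex derivatives: the scalar field is R[i]. *)

Definition charpoly (R : realType) (k : nat) (a : nat -> R[i]) : {poly R[i]} :=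
  \poly_(j < k.+1) a j.

Definition char_roots (R : realType) (k : nat) (a : nat -> R[i]) : set R[i] :=
  [set z | root (charpoly k a) z].

Definition cderiv (R : realType) (n : nat) (y : R[i] -> R[i]) : R[i] -> R[i] :=
  derive1n n (y : R[i]^o -> R[i]^o).

Definition cdifferentiable (R : realType) (y : R[i] -> R[i]) : Prop :=
  forall z : R[i], derivable (y : R[i]^o -> R[i]^o) z 1.

(* Differentiability is required explicitly up to order k, since cderiv has a
   value also where the derivative does not exist.  For k > 0 the case j = 0
   says that y is entire. *)
Definition is_solution (R : realType) (k : nat) (a : nat -> R[i])
    (y : R[i] -> R[i]) : Prop :=
  (forall j : nat, (j < k)%N -> cdifferentiable (cderiv j y)) /\
  (forall z : R[i], \sum_(j < k.+1) a j * cderiv j y z = 0).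

Definition nontrivial (R : realType) (y : R[i] -> R[i]) : Prop :=
  exists z, y z <> 0.

Definition strip (R : realType) (alpha : R) : set R[i] :=
  [set z | `|complex.Im z| <= alpha].

(* Order of vanishing of y at z: the least n with y^(n)(z) <> 0; it is 0 when
   y z <> 0, and +oo when all the derivatives of y vanish at z. *)
Definition multiplicity (R : realType) (y : R[i] -> R[i]) (z : R[i]) : \bar R :=
  ereal_inf [set (n%:R)%:E | n in [set n : nat | cderiv n y z <> 0]].

(* Points which are not zeros contribute 0. *)
Definition zero_count (R : realType) (y : R[i] -> R[i]) (A : set R[i]) : \bar R :=
  \esum_(z in A) multiplicity y z.

Fixpoint polyline_length (R : realType) (v : R[i]) (s : seq R[i]) : R :=
  if s is w :: s' then ComplexField.Normc.normc (w - v) + polyline_length w s'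
  else 0.

Definition segment (R : realType) (v w : R[i]) : set R[i] :=
  [set v + t%:C * (w - v) | t in [set t : R | 0 <= t <= 1]].

(* The polygonal path with successive vertices v :: s, as a set of points. *)
Fixpoint polyline (R : realType) (v : R[i]) (s : seq R[i]) : set R[i] :=
  if s is w :: s' then segment v w `|` polyline w s' else [set v].

(* The vertices of the paths are not required to belong to S. *)
Definition shortest_polyline (R : realType) (S : set R[i]) : R :=
  inf [set l | exists v s, S `<=` polyline v s /\ l = polyline_length v s].

(* The maxima are over positive numbers, resp. nonnegative ones; they are 0 for
   k <= 1, when there is no pair of consecutive roots. *)
Definition Theta (R : realType) (k : nat) (lambda : nat -> R[i]) : R :=
  \big[Num.max/0]_(1 <= j < k)
    `|complex.Re (lambda j) - complex.Re (lambda j.+1)|^-1.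

Definition Xi (R : realType) (k : nat) (lambda : nat -> R[i]) : R :=
  \big[Num.max/0]_(1 <= j < k)
    `|(complex.Im (lambda j) - complex.Im (lambda j.+1)) /
      (complex.Re (lambda j) - complex.Re (lambda j.+1))|.

(* Main.v *)
Require Import Defs.
From HB Require Import structures.
From mathcomp Require Import all_boot all_order all_algebra.
From mathcomp Require Import complex.
From mathcomp Require Import all_classical all_reals all_analysis.
From mathcomp Require Import ring lra zify.
Import Order.TTheory GRing.Theory Num.Theory.
Import numFieldNormedType.Exports.
Import ComplexField.Normc.
Set Implicit Arguments.
Unset Strict Implicit.
Unset Printing Implicit Defensive.
Local Open Scope ring_scope.
Local Open Scope complex_scope.
Local Open Scope classical_set_scope.

(** Why it is true.  Write the equation as
[(D - a_1) (D - a_2) ... (D - a_k) y = 0], the roots being taken in any order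
(repeated according to multiplicity).  A solution is a sum of terms
[p(z) exp(a z)], one for each distinct root [a], where [p] is a polynomial.

Location of the zeros.  At a zero of [y] no term can exceed the sum of the
others in modulus.  Order the terms by the real part of the exponent.  A zero
then has a crossing index [m]: among the terms up to [m] and among those
beyond [m] there are two that are comparable within powers of 3
([crossing_exists]).  When [z] moves to the right by more than a slope times
its vertical displacement, the later terms gain on the earlier ones
exponentially fast, so zeros of the strip with the same crossing index have
nearly the same real part ([crossing_spread], [crossing_strip]).  If all roots
are simple, the polynomials are constant and the zeros lie in [k - 1]
rectangles of height [2 alpha] and width [2 alpha Xi + 2 Theta ln 3].  If not,
the same holds far from the zeros of the polynomials [p], whose growth is then
too slow to matter ([poly_growth]); the remaining zeros of [y] lie in a bounded
number of rectangles of bounded width.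

Zeros in one rectangle.  By the argument principle ([argument_principle]) the
number of zeros of [y] in a rectangle is at most [1 / (2 pi)] times the total
variation of the argument of [y] along the boundary.  Here Rolle's theorem has
an analogue ([arg_var_rolle]): along a closed convex curve the variation for
[f] exceeds the one for [f'] by at most [2 pi], the total turning of the curve.
Applied to [exp(- a z) y] it compares [y] with [(D - a) y]; passing from the
factor [exp(- a z)] to [exp(- b z)] costs [|b - a|] times the perimeter.  After
at most [k - 1] steps the function is a pure exponential.  Hence the rectangle
contains at most [(k - 1) + L P / (2 pi)] zeros ([zeros_in_rect]), where [P] is
the perimeter and [L] the length of the polygonal line [a_1, a_2, ..., a_k].
A polygonal path that passes through all the roots meets them in an order in
which they form a line of no greater length ([polyline_shortcut]), so [L] may be
replaced by the length of the shortest path.  Adding up over the rectangles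
gives both bounds ([zero_count_classes], [finite_bound], [explicit_bound]).

Everything is expressed by logarithmic derivatives [f' / f] on the sides of the
rectangle.  A bound for the variation of the argument is a real function [W] on
each side with [W' >= |Im (u f' / f)|], where [u] is the direction of the side;
its increment takes the place of the integral of the speed. *)

Local Notation Re := complex.Re.
Local Notation Im := complex.Im.

(** * Modulus, real and imaginary part *)

Section Norm.
Variable R : realType.
Implicit Types z w : R[i].

Lemma normc_sqr z : normc z ^+ 2 = Re z ^+ 2 + Im z ^+ 2.
Proof. by case: z => a b /=; rewrite sqr_sqrtr // addr_ge0 ?sqr_ge0. Qed.

Lemma normc_ge0 z : 0 <= normc z.
Proof. by case: z => a b /=; rewrite sqrtr_ge0. Qed.

Lemma normcX z n : normc (z ^+ n) = normc z ^+ n.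
Proof.
elim: n => [|n IH]; first by rewrite !expr0 normc1.
by rewrite !exprS normcM IH.
Qed.

Lemma normc_eq0 z : (normc z == 0) = (z == 0).
Proof.
apply/eqP/eqP => [/eq0_normc //|->].
exact: normc0.
Qed.

Lemma normc_gt0 z : (0 < normc z) = (z != 0).
Proof. by rewrite lt_neqAle normc_ge0 andbT eq_sym normc_eq0. Qed.

Lemma normcB z w : normc (z - w) = normc (w - z).
Proof. by rewrite -normcN opprB. Qed.

Lemma ler_normcBD z w v : normc (z - w) <= normc (z - v) + normc (v - w).
Proof. by apply: le_trans (le_normcD _ _); rewrite addrA subrK. Qed.

Lemma ler_normcB z w : normc z - normc w <= normc (z - w).
Proof. by rewrite lerBlDr; apply: le_trans (le_normcD _ _); rewrite subrK. Qed.

Lemma normcR (x : R) : normc x%:C = `|x|.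
Proof. by rewrite /= expr0n /= addr0 sqrtr_sqr. Qed.

Lemma ler_Re_normc z : `|Re z| <= normc z.
Proof.
by rewrite -ler_sqr ?nnegrE ?normr_ge0 ?normc_ge0// normc_sqr real_normK ?num_real// lerDl sqr_ge0.
Qed.

Lemma ler_Im_normc z : `|Im z| <= normc z.
Proof.
by rewrite -ler_sqr ?nnegrE ?normr_ge0 ?normc_ge0// normc_sqr real_normK ?num_real// lerDr sqr_ge0.
Qed.

Lemma normc_le z : normc z <= `|Re z| + `|Im z|.
Proof.
rewrite -ler_sqr ?nnegrE ?addr_ge0 ?normr_ge0 ?normc_ge0// normc_sqr.
rewrite sqrrD !real_normK ?num_real//.
have : 0 <= `|Re z| * `|Im z| *+ 2 by rewrite mulrn_wge0 // mulr_ge0.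
lra.
Qed.

Lemma ReM z w : Re (z * w) = Re z * Re w - Im z * Im w.
Proof. by case: z; case: w. Qed.

Lemma ImM z w : Im (z * w) = Re z * Im w + Im z * Re w.
Proof. by case: z; case: w. Qed.

Lemma ReD z w : Re (z + w) = Re z + Re w.
Proof. by case: z; case: w. Qed.
Lemma ImD z w : Im (z + w) = Im z + Im w.
Proof. by case: z; case: w. Qed.
Lemma ReN z : Re (- z) = - Re z.
Proof. by case: z. Qed.
Lemma ImN z : Im (- z) = - Im z.
Proof. by case: z. Qed.

Lemma ReV z : Re z^-1 = Re z / (Re z ^+ 2 + Im z ^+ 2).
Proof. by case: z. Qed.
Lemma ImV z : Im z^-1 = - Im z / (Re z ^+ 2 + Im z ^+ 2).
Proof. by case: z => a b /=; rewrite mulNr. Qed.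

Lemma ReImP z w : Re z = Re w -> Im z = Im w -> z = w.
Proof. by case: z; case: w => a b c d /= -> ->. Qed.

Definition ReImE := (ReM, ImM, ReD, ImD, ReN, ImN).

Lemma normC_normc z : `|z| = (normc z)%:C.
Proof. by case: z. Qed.

Lemma ltr_normc z (e : R) : (`|z| < e%:C) = (normc z < e).
Proof. by rewrite normC_normc ltcR. Qed.

End Norm.

(** * Complex-valued functions of a real variable *)

Section PathDerivative.
Variable R : realType.

Definition path_diff (F : R -> R[i]) (s : R) (l : R[i]) : Prop :=
  is_derive s 1 (fun t => Re (F t)) (Re l) /\
  is_derive s 1 (fun t => Im (F t)) (Im l).

Lemma path_diff_cst c s : path_diff (fun=> c) s 0.
Proof. by split; apply: is_derive_cst. Qed.

Lemma path_diffD F G s l m : path_diff F s l -> path_diff G s m -> path_diff (fun t => F t + G t) s (l + m).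
Proof.
move=> [F1 F2] [G1 G2]; split.
  under eq_fun do rewrite ReD.
  by rewrite ReD; exact: is_deriveD.
under eq_fun do rewrite ImD.
by rewrite ImD; exact: is_deriveD.
Qed.

Lemma path_diffN F s l : path_diff F s l -> path_diff (fun t => - F t) s (- l).
Proof.
move=> [F1 F2]; split.
  under eq_fun do rewrite ReN.
  by rewrite ReN; exact: is_deriveN.
under eq_fun do rewrite ImN.
by rewrite ImN; exact: is_deriveN.
Qed.

Lemma path_diffM F G s l m : path_diff F s l -> path_diff G s m ->
  path_diff (fun t => F t * G t) s (l * G s + F s * m).
Proof.
move=> [F1 F2] [G1 G2]; split.
  under eq_fun do rewrite ReM.
  apply: (is_derive_eq (is_deriveB (is_deriveM F1 G1) (is_deriveM F2 G2))).
  by rewrite !ReImE /GRing.scale /=; ring.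
under eq_fun do rewrite ImM.
apply: (is_derive_eq (is_deriveD (is_deriveM F1 G2) (is_deriveM F2 G1))).
by rewrite !ReImE /GRing.scale /=; ring.
Qed.

Lemma path_diff_eq F G s l m : path_diff F s l -> F =1 G -> l = m -> path_diff G s m.
Proof. by move=> H /funext <- <-. Qed.

Lemma path_diff_line z (u : R[i]) s : path_diff (fun t => z + t%:C * u) s u.
Proof.
split.
  under eq_fun do rewrite ReD ReM /= mul0r subr0.
  apply: (is_derive_eq (is_deriveD (is_derive_cst _ _ _) (is_deriveM (is_derive_id _ _) (is_derive_cst _ _ _)))).
  by rewrite /GRing.scale /=; ring.
under eq_fun do rewrite ImD ImM /= mul0r addr0.
apply: (is_derive_eq (is_deriveD (is_derive_cst _ _ _) (is_deriveM (is_derive_id _ _) (is_derive_cst _ _ _)))).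
by rewrite /GRing.scale /=; ring.
Qed.

Lemma path_diffV F s l : path_diff F s l -> F s != 0 ->
  path_diff (fun t => (F t)^-1) s (- l * (F s)^-1 * (F s)^-1).
Proof.
move=> [F1 F2] Fs0.
have n0 : Re (F s) ^+ 2 + Im (F s) ^+ 2 != 0.
  by rewrite -normc_sqr expf_neq0 // normc_eq0.
have dN : is_derive s 1 (fun t => Re (F t) ^+ 2 + Im (F t) ^+ 2)
    (2 * Re (F s) * Re l + 2 * Im (F s) * Im l).
  apply: (is_derive_eq (is_deriveD (is_deriveX 2 F1) (is_deriveX 2 F2))).
  by rewrite /GRing.scale /= !expr1.
have dV := (fun h => is_deriveV h dN) n0.
split.
  under eq_fun do rewrite ReV.
  apply: (is_derive_eq (is_deriveM F1 dV)).
  by rewrite !ReImE ReV ImV /GRing.scale /=; field.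
under eq_fun do rewrite ImV.
have F2N : is_derive s 1 (fun t => - Im (F t)) (- Im l) by exact: is_deriveN.
apply: (is_derive_eq (is_deriveM F2N dV)).
by rewrite !ReImE ReV ImV /GRing.scale /=; field.
Qed.

End PathDerivative.

(** * Complex derivatives and derivatives along lines *)

Section ComplexDerivative.
Variable R : realType.
Implicit Types (f g : R[i] -> R[i]).

Definition cdiff_at f z l := forall e : R, 0 < e -> exists2 d : R, 0 < d &
  forall h : R[i], normc h < d -> normc (f (z + h) - f z - l * h) <= e * normc h.

Lemma gt0_complex_real (e : R[i]) : 0 < e -> exists2 r : R, 0 < r & e = r%:C.
Proof.
rewrite ltcE => /andP[/eqP/= e0 e1]; exists (Re e) => //.
by apply: ReImP => //=.
Qed.

Lemma near0_complexP (P : R[i] -> Prop) :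
  (\forall h \near (0 : R[i]^o)^', P h) <->
  (exists2 d : R, 0 < d & forall h, h != 0 -> normc h < d -> P h).
Proof.
split.
  rewrite near_withinE => /nbhs_ballP[e /= /gt0_complex_real[r r0 ->] H].
  exists r => // h h0 hr; apply: H => //.
  by rewrite -ball_normE /ball_ /= sub0r normrN ltr_normc.
move=> [d d0 H]; rewrite near_withinE; apply/nbhs_ballP.
exists d%:C => /=; first by rewrite ltcR.
move=> h; rewrite -ball_normE /ball_ /= sub0r normrN ltr_normc => hd h0.
exact: H.
Qed.

(** The modulus of [R[i]] takes values in [R[i]]; this turns the derivative over
that field into a statement with real bounds. *)
Lemma cdiff_atP f z l : cdiff_at f z l <->
  is_derive (z : R[i]^o) (1 : R[i]^o) (f : R[i]^o -> R[i]^o) (l : R[i]^o).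
Proof.
have E h : h != 0 -> normc (l - h^-1 * (f (h * 1 + z) - f z)) =
   normc (f (z + h) - f z - l * h) / normc h.
  move=> h0; rewrite -normcV -normcM normcB; congr normc.
  by rewrite mulr1 (addrC h); field.
have D : cdiff_at f z l <->
  h^-1 *: (((f : R[i]^o -> R[i]^o) \o shift z) (h *: (1 : R[i]^o)) - f z) @[h --> (0 : R[i]^o)^'] --> (l : R[i]^o).
  rewrite (cvgrPdist_lt (FF := _)); split.
    move=> H e /gt0_complex_real[r r0 ->].
    apply/near0_complexP; have [d d0 K] := H (r / 2) (divr_gt0 r0 (ltr0n _ 2)).
    exists d => // h h0 hd; rewrite ltr_normc.
    rewrite E // ltr_pdivrMr ?normc_gt0 //.
    by apply: (le_lt_trans (K _ hd)); rewrite ltr_pM2r ?normc_gt0 //; lra.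
  move=> H e e0.
  have /H/near0_complexP[d d0 K] : 0 < e%:C by rewrite ltcR.
  exists d => // h hd.
  have [->|h0] := eqVneq h 0.
    by rewrite addr0 subrr mulr0 subr0 normc0 mulr0.
  have := K h h0 hd; rewrite ltr_normc E // ltr_pdivrMr ?normc_gt0 // => /ltW.
  by [].
split.
  move/D => H; apply: DeriveDef; first by apply/cvg_ex; exists l.
  exact: (cvg_lim (@norm_hausdorff _ _) H).
move=> H; apply/D; have := @ex_derive _ _ _ _ _ _ _ H.
move=> /cvg_ex[m Hm].
have E1 := @derive_val _ _ _ _ _ _ _ H.
have E2 : 'D_1 (f : R[i]^o -> R[i]^o) z = m
  by exact: (cvg_lim (@norm_hausdorff _ _) Hm).
by rewrite (_ : l = m) //; exact: etrans (esym E1) E2.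
Qed.

Definition cdiff f f' := forall z, cdiff_at f z (f' z).

Definition ccontinuous f z := forall e : R, 0 < e -> exists2 d : R, 0 < d &
  forall h : R[i], normc h < d -> normc (f (z + h) - f z) < e.

Lemma cdifferentiable_cdiff f : cdifferentiable f -> cdiff f (cderiv 1 f).
Proof.
move=> H z; apply/cdiff_atP; have := derivableP (H z).
by rewrite /cderiv /= derive1E.
Qed.

Lemma cdiff_cderiv f f' : cdiff f f' -> cderiv 1 f = f'.
Proof.
move=> H; apply/funext => z; rewrite /cderiv /= derive1E.
by have /cdiff_atP K := H z; rewrite (@derive_val _ _ _ _ _ _ _ K).
Qed.

Lemma cdiff_cdifferentiable f f' : cdiff f f' -> cdifferentiable f.
Proof. by move=> H z; have /cdiff_atP K := H z; exact: (@ex_derive _ _ _ _ _ _ _ K). Qed.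

Lemma cdiff_subZ f f' g g' (a : R[i]) : cdiff f f' -> cdiff g g' ->
  cdiff (fun z => f z - a * g z) (fun z => f' z - a * g' z).
Proof.
move=> Hf Hg z; have /cdiff_atP Kf := Hf z; have /cdiff_atP Kg := Hg z.
exact/cdiff_atP.
Qed.

Lemma cdiff_at_ccontinuous f z l : cdiff_at f z l -> ccontinuous f z.
Proof.
move=> H e e0; have [d d0 K] := H 1 ltr01.
have m0 : 0 < 1 + normc l + 1 by have := normc_ge0 l; lra.
exists (Num.min d (e / (1 + normc l + 1))).
  by rewrite lt_min d0 divr_gt0.
move=> h; rewrite lt_min => /andP[/K hd he].
have -> : f (z + h) - f z = f (z + h) - f z - l * h + l * h by rewrite subrK.
apply: (le_lt_trans (le_normcD _ _)).
move: hd; rewrite mul1r normcM; move: he; rewrite ltr_pdivlMr //.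
have := normc_ge0 h; have := normc_ge0 l; nra.
Qed.

(** Complex differentiability seen along real lines only.  It is what the mean value
theorem and the argument along a segment use, and unlike [cdiff] it can be
verified for exponentials by real calculus. *)
Definition line_diff f f' := forall z u s,
  path_diff (fun t => f (z + t%:C * u)) s (u * f' (z + s%:C * u)).

Lemma near0_real (P : R -> Prop) :
  (exists2 d : R, 0 < d & forall h, h != 0 -> `|h| < d -> P h) ->
  (\forall h \near (0 : R)^', P h).
Proof.
move=> [d d0 H]; rewrite near_withinE; apply/nbhs_ballP.
exists d => //= h; rewrite -ball_normE /ball_ /= sub0r normrN => hd h0.
exact: H.
Qed.

Lemma is_derive_eps (F : R -> R) (s l : R) :
  (forall e, 0 < e -> exists2 d, 0 < d & forall h, `|h| < d ->
     `|F (s + h) - F s - l * h| <= e * `|h|) -> is_derive s 1 F l.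
Proof.
move=> H.
suff K : h^-1 *: ((F \o shift s) (h *: (1:R)) - F s) @[h --> 0^'] --> l.
  apply: DeriveDef; first by apply/cvg_ex; exists l.
  exact: (cvg_lim (@norm_hausdorff _ _) K).
rewrite (cvgrPdist_lt (FF := _)) => e e0; apply: near0_real.
have [d d0 K] := H (e / 2) (divr_gt0 e0 (ltr0n _ 2)).
exists d => // h h0 /K; rewrite /= /GRing.scale /= mulr1 (addrC h) => Kh.
have -> : l - h^-1 * (F (s + h) - F s) = - ((F (s + h) - F s - l * h) / h).
  by field.
rewrite normrN normrM normfV ltr_pdivrMr ?normr_gt0 //.
have : 0 < `|h| by rewrite normr_gt0.
nra.
Qed.

Lemma cdiff_line_diff f f' : cdiff f f' -> line_diff f f'.
Proof.
move=> H z u s; set w := z + s%:C * u.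
have K (e : R) : 0 < e -> exists2 d, 0 < d & forall h : R, `|h| < d ->
    normc (f (z + (s + h)%:C * u) - f w - u * f' w * h%:C) <= e * `|h|.
  move=> e0; have m0 : 0 < 1 + normc u by have := normc_ge0 u; lra.
  have [d d0 K] := H w (e / (1 + normc u)) (divr_gt0 e0 m0).
  exists (d / (1 + normc u)); first by rewrite divr_gt0.
  move=> h; rewrite ltr_pdivlMr // => hd.
  have un := normc_ge0 u; have hn := normr_ge0 h.
  have /K : normc (h%:C * u) < d by rewrite normcM normcR; nra.
  have -> : w + h%:C * u = z + (s + h)%:C * u.
    by rewrite /w -addrA -mulrDl -rmorphD.
  rewrite normcM normcR (mulrCA (f' w)) [h%:C * _]mulrC [f' w * u]mulrC.
  move=> /le_trans; apply; rewrite mulrAC ler_pdivrMr //.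
  have := mulr_ge0 (ltW e0) hn; nra.
split; apply: is_derive_eps => e /K[d d0 Hd]; exists d => // h /Hd;
  apply: le_trans.
  apply: le_trans (ler_Re_normc _).
  by rewrite !ReImE /= !mulr0 subr0.
apply: le_trans (ler_Im_normc _).
by rewrite !ReImE /= !mulr0 add0r [_ * h]mulrC.
Qed.

(** There is no intermediate point for the whole increment [c], but there is one for
the component of the path in the direction of [c], which is all that counts. *)
Lemma path_mean_value (F F' : R -> R[i]) (M : R) :
  (forall s, path_diff F s (F' s)) -> (forall s, 0 <= s <= 1 -> normc (F' s) <= M) ->
  normc (F 1 - F 0) <= M.
Proof.
move=> HF HM; set c := F 1 - F 0.
have [->|c0] := eqVneq c 0.
  by rewrite normc0; apply: le_trans (HM 0 _); rewrite ?normc_ge0// lexx ler01.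
(* The scalar product of the path with its increment. *)
pose G t := Re c * Re (F t) + Im c * Im (F t).
have dG (s : R) : is_derive s 1 G (Re c * Re (F' s) + Im c * Im (F' s)).
  have [h1 h2] := HF s; rewrite /G.
  exact: (is_deriveD (is_deriveZ (Re c) h1) (is_deriveZ (Im c) h2)).
have cG : {within `[0, 1], continuous G}.
  apply: continuous_subspaceT => x; apply: differentiable_continuous.
  by apply/derivable1_diffP; exact: (@ex_derive _ _ _ _ _ _ _ (dG x)).
have [x xI] := @MVT _ G _ 0 1 ltr01 (fun x _ => dG x) cG.
have -> : G 1 - G 0 = normc c ^+ 2.
  rewrite normc_sqr /G /c !ReImE; ring.
rewrite subr0 mulr1 => E.
have xM : normc (F' x) <= M.
  by apply: HM; move: xI; rewrite in_itv /= => /andP[/ltW -> /ltW ->].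
have cn : 0 < normc c by rewrite normc_gt0.
rewrite -(ler_pM2l cn) -expr2 E.
apply: le_trans (_ : normc c * normc (F' x) <= _); last by rewrite ler_pM2l.
have -> : Re c * Re (F' x) + Im c * Im (F' x) = Re ((Re c -i* Im c) * F' x).
  by rewrite ReM /=; ring.
apply: le_trans (ler_norm _) _; apply: le_trans (ler_Re_normc _) _.
rewrite normcM; have -> // : normc (Re c -i* Im c) = normc c.
by rewrite /= sqrrN; case: (c).
Qed.

Lemma line_mean_value f f' z h (M : R) : line_diff f f' ->
  (forall s, 0 <= s <= 1 -> normc (f' (z + s%:C * h)) <= M) ->
  normc (f (z + h) - f z) <= normc h * M.
Proof.
move=> H HM; have := @path_mean_value (fun t => f (z + t%:C * h)) _ (normc h * M) (H z h).
rewrite mul0r addr0 mul1r; apply => s s01.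
by rewrite normcM ler_wpM2l ?normc_ge0 // HM.
Qed.

Lemma line_diff0_cst f : line_diff f (fun=> 0) -> forall z w, f z = f w.
Proof.
move=> H z w; apply/eqP; rewrite -subr_eq0 -normc_eq0 eq_le normc_ge0 andbT.
have := @line_mean_value f _ w (z - w) 0 H; rewrite mulr0 [w + _]addrC subrK; apply=> s _.
by rewrite normc0.
Qed.

Lemma path_diffX (F : R -> R[i]) s l n : path_diff F s l ->
  path_diff (fun t => F t ^+ n.+1) s (n.+1%:R * l * F s ^+ n).
Proof.
move=> H; elim: n => [|n IH].
  by apply: (path_diff_eq H) => [t|]; rewrite ?expr1 // mul1r expr0 mulr1.
apply: (path_diff_eq (path_diffM H IH)) => [t|]; first by rewrite -exprS.
rewrite exprS -[n.+2]add1n natrD; ring.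
Qed.

(** * Order of vanishing *)

(** The first-order expansion [f (z + h) = c h^m + o(h^m)]; it includes continuity,
and [m = 0] means [f z <> 0]. *)
Definition zero_order f z m := exists2 c, c != 0 & forall e : R, 0 < e ->
  exists2 d : R, 0 < d & forall h, normc h < d ->
    normc (f (z + h) - c * h ^+ m) <= e * normc h ^+ m.

Lemma zero_order0 f z : ccontinuous f z -> f z != 0 -> zero_order f z 0.
Proof.
move=> H fz; exists (f z) => // e /H[d d0 K]; exists d => // h /K /ltW.
by rewrite !expr0 !mulr1.
Qed.

(** Integrate the expansion of [f']: the mean value theorem is applied to
[f (z + h) - c / (m + 1) h^(m + 1)], whose derivative is [o(h^m)]. *)
Lemma zero_orderS f f' z m : line_diff f f' -> f z = 0 -> zero_order f' z m ->
  zero_order f z m.+1.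
Proof.
move=> Hf fz [c c0 H]; exists (c / m.+1%:R).
  by rewrite mulf_neq0 // invr_neq0 // pnatr_eq0.
move=> e e0; have [d d0 K] := H e e0; exists d => // h hd.
pose F (t : R) := f (z + t%:C * h) - c / m.+1%:R * (0 + t%:C * h) ^+ m.+1.
have dF (s : R) : path_diff F s (h * (f' (z + s%:C * h) - c * (s%:C * h) ^+ m)).
  apply: (path_diff_eq (path_diffD (Hf z h s) (path_diffN (path_diffM (path_diff_cst (c / m.+1%:R) s) (path_diffX m (path_diff_line 0 h s)))))) => //.
  rewrite add0r; field.
  by rewrite nat1r pnatr_eq0.
have := path_mean_value dF; rewrite /F mul0r mul1r !add0r addr0 fz expr0n /= mulr0 !subr0.
apply=> s /andP[s0 s1].
have shh : normc (s%:C * h) <= normc h.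
  by rewrite normcM normcR ger0_norm // ler_piMl // normc_ge0.
rewrite normcM exprS mulrCA ler_wpM2l ?normc_ge0 //.
apply: le_trans (K _ (le_lt_trans shh hd)) _.
by rewrite ler_wpM2l ?(ltW e0) // lerXn2r ?nnegrE ?normc_ge0.
Qed.

End ComplexDerivative.

(** * Equations with constant coefficients as chains of first-order equations *)

Section Chain.
Variable R : realType.
Implicit Types (f g : R[i] -> R[i]) (s r : seq R[i]) (a : R[i]).

Definition Dsub a f := fun z => cderiv 1 f z - a * f z.

Definition smooth n f := forall j : nat, (j < n)%N -> cdifferentiable (cderiv j f).

(** [(D - a_1) ... (D - a_n) f = 0], the factors being applied from the head of the
list.  The smoothness required of [f] is inherited along the chain. *)
Fixpoint annihilated s f : Prop := smooth (size s) f /\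
  match s with [::] => forall z, f z = 0 | a :: s' => annihilated s' (Dsub a f) end.

Lemma cderivS n f : cderiv n.+1 f = cderiv 1 (cderiv n f).
Proof. by []. Qed.

Lemma cderivSr n f : cderiv n.+1 f = cderiv n (cderiv 1 f).
Proof. by rewrite /cderiv /derive1n iterSr. Qed.

Lemma smoothW m n f : (m <= n)%N -> smooth n f -> smooth m f.
Proof. by move=> mn H j jm; apply: H; exact: leq_trans jm mn. Qed.

Lemma cderiv_Dsub n a f : smooth n.+1 f ->
  cderiv n (Dsub a f) = fun z => cderiv n.+1 f z - a * cderiv n f z.
Proof.
elim: n => [|n IH] H //.
rewrite cderivS IH; last exact: smoothW H.
by apply: cdiff_cderiv; apply: cdiff_subZ; apply: cdifferentiable_cdiff; apply: H.
Qed.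

Lemma smooth_Dsub n a f : smooth n.+1 f -> smooth n (Dsub a f).
Proof.
move=> H j jn; rewrite cderiv_Dsub; last by apply: smoothW H; rewrite ltnS ltnW.
apply: (@cdiff_cdifferentiable _ _ (fun z => cderiv j.+2 f z - a * cderiv j.+1 f z)).
by apply: cdiff_subZ; apply: cdifferentiable_cdiff; apply: H => //; exact: ltnW.
Qed.

Lemma smooth_cdiff n f : smooth n.+1 f -> cdiff f (cderiv 1 f).
Proof. by move=> H; apply: cdifferentiable_cdiff; exact: (H 0). Qed.

Lemma annihilated_smooth s f : annihilated s f -> smooth (size s) f.
Proof. by case: s => [|a s] []. Qed.

Lemma annihilated_cons a s f : annihilated (a :: s) f -> cdiff f (cderiv 1 f) /\ annihilated s (Dsub a f).
Proof. by move=> [/smooth_cdiff]. Qed.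

(** Divide the operator by the factor of the head of the list: the coefficients of
[Q (X - a)] applied to the derivatives of [f] are those of [Q] applied to the
derivatives of [Dsub a f]. *)
Lemma annihilated_factor s f c : c != 0 -> smooth (size s) f ->
  (forall z, \sum_(j < (size s).+1) (c *: \prod_(a <- s) ('X - a%:P))`_j * cderiv j f z = 0) ->
  annihilated s f.
Proof.
move=> c0; elim: s f => [|a s IH] f sm H.
  split=> // z; have := H z; rewrite big_nil big_ord1 coefZ coef1 mulr1 => /eqP.
  by rewrite mulf_eq0 (negbTE c0) => /eqP.
split=> //; apply: IH; first exact: smooth_Dsub.
move=> z; have := H z; rewrite big_cons mulrC scalerAl.
set Q := c *: _; rewrite [size (_ :: _)]/=.
have Qs : (size Q <= (size s).+1)%N.
  by rewrite (leq_trans (size_scale_leq _ _)) // size_prod_XsubC.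
move=> E; rewrite -[RHS]E; under [RHS]eq_bigr => j _ do rewrite mulrBr coefB coefMX coefMC mulrBl.
rewrite sumrB [X in _ = X - _]big_ord_recl /= mul0r add0r.
rewrite [X in _ = _ - X]big_ord_recr /= (nth_default 0 Qs) !mul0r addr0.
rewrite -sumrB; apply: eq_bigr => j _.
rewrite cderiv_Dsub; last exact: smoothW (ltn_ord j) sm.
by rewrite mulrBr mulrA.
Qed.

(** * Exponentials *)

Definition cis (t : R) : R[i] := cos t +i* sin t.

Definition cexp a : R[i] -> R[i] :=
  fun z => (expR (Re (a * z)))%:C * cis (Im (a * z)).

Lemma cis0 : cis 0 = 1.
Proof. by rewrite /cis cos0 sin0. Qed.

Lemma cisD t u : cis (t + u) = cis t * cis u.
Proof. by apply: ReImP; rewrite !ReImE /= ?cosD ?sinD //; ring. Qed.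

Lemma normc_cis t : normc (cis t) = 1.
Proof. by rewrite /= cos2Dsin2 sqrtr1. Qed.

Lemma normc_cexp a z : normc (cexp a z) = expR (Re (a * z)).
Proof. by rewrite normcM normc_cis mulr1 normcR gtr0_norm // expR_gt0. Qed.

Lemma cexpN a z : cexp a z * cexp (- a) z = 1.
Proof.
rewrite /cexp mulNr ReN ImN mulrACA -rmorphM -cisD /=.
by rewrite -expRD !subrr expR0 cis0 mulr1.
Qed.

Lemma cexp_neq0 a z : cexp a z != 0.
Proof. by rewrite -normc_gt0 normc_cexp expR_gt0. Qed.

Lemma line_diff_cexp a : line_diff (cexp a) (fun z => a * cexp a z).
Proof.
move=> z u s.
have [d1 d2] := path_diffM (path_diff_cst a s) (path_diff_line z u s).
have dE := is_derive1_comp (is_derive_expR (Re (a * (z + s%:C * u)))) d1.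
have dC := is_derive1_comp (is_derive_cos (Im (a * (z + s%:C * u)))) d2.
have dS := is_derive1_comp (is_derive_sin (Im (a * (z + s%:C * u)))) d2.
rewrite mul0r add0r in dE dC dS.
split.
  rewrite (_ : (fun t => _) = (fun t => expR (Re (a * (z + t%:C * u))) * cos (Im (a * (z + t%:C * u))))); last first.
    by apply/funext => t; rewrite /cexp ReM /= mul0r subr0.
  apply: (is_derive_eq (is_deriveM dE dC)).
  by rewrite /comp /cexp /GRing.scale !ReImE /=; ring.
rewrite (_ : (fun t => _) = (fun t => expR (Re (a * (z + t%:C * u))) * sin (Im (a * (z + t%:C * u))))); last first.
  by apply/funext => t; rewrite /cexp ImM /= mul0r addr0.
apply: (is_derive_eq (is_deriveM dE dS)).
by rewrite /comp /cexp /GRing.scale !ReImE /=; ring.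
Qed.

Lemma line_diff_cst a : line_diff (fun=> a) (fun=> 0).
Proof. by move=> z u s; rewrite mulr0; exact: path_diff_cst. Qed.

Lemma line_diffD f f' g g' : line_diff f f' -> line_diff g g' ->
  line_diff (fun z => f z + g z) (fun z => f' z + g' z).
Proof. by move=> Hf Hg z u s; rewrite mulrDr; exact: path_diffD. Qed.

Lemma line_diffN f f' : line_diff f f' -> line_diff (fun z => - f z) (fun z => - f' z).
Proof. by move=> Hf z u s; rewrite mulrN; exact: path_diffN. Qed.

Lemma line_diffM f f' g g' : line_diff f f' -> line_diff g g' ->
  line_diff (fun z => f z * g z) (fun z => f' z * g z + f z * g' z).
Proof.
move=> Hf Hg z u s; apply: (path_diff_eq (path_diffM (Hf z u s) (Hg z u s))) => //.
by ring.
Qed.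

Lemma line_diff_eq f f' g g' : line_diff f f' -> f =1 g -> f' =1 g' -> line_diff g g'.
Proof. by move=> H /funext <- /funext <-. Qed.

Lemma line_diff_id : line_diff (@id R[i]) (fun=> 1).
Proof. by move=> z u s; rewrite mulr1; exact: path_diff_line. Qed.

Lemma line_diff_poly (p : {poly R[i]}) : line_diff (fun z => p.[z]) (fun z => p^`().[z]).
Proof.
elim/poly_ind: p => [|p c IH].
  by apply: (line_diff_eq (line_diff_cst 0)) => z; rewrite ?deriv0 horner0.
apply: (line_diff_eq (line_diffD (line_diffM IH line_diff_id) (line_diff_cst c))) => z.
  by rewrite hornerMXaddC.
by rewrite derivMXaddC !hornerE; ring.
Qed.

Lemma line_diff_sum (I : Type) (l : seq I) (F F' : I -> R[i] -> R[i]) :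
  (forall i, line_diff (F i) (F' i)) ->
  line_diff (fun z => \sum_(i <- l) F i z) (fun z => \sum_(i <- l) F' i z).
Proof.
move=> H; elim: l => [|i l IH].
  by apply: (line_diff_eq (line_diff_cst 0)) => z; rewrite big_nil.
by apply: (line_diff_eq (line_diffD (H i) IH)) => z; rewrite big_cons.
Qed.

(** The product of [f] with [exp(- a z)] has derivative zero. *)
Lemma exponential_solution a f : line_diff f (fun z => a * f z) ->
  forall z w, f z = f w * cexp (- a) w * cexp a z.
Proof.
move=> H z w.
have /line_diff0_cst /(_ z w) : line_diff (fun z => f z * cexp (- a) z) (fun=> 0).
  by apply: (line_diff_eq (line_diffM H (@line_diff_cexp (- a)))) => // t; ring.
move=> <-; rewrite -mulrA [cexp _ _ * _]mulrC cexpN; ring.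
Qed.

Lemma Dsub0_line_diff a f : cdiff f (cderiv 1 f) -> (forall z, Dsub a f z = 0) ->
  line_diff f (fun z => a * f z).
Proof.
move=> /cdiff_line_diff H K; apply: (line_diff_eq H) => // z.
by apply/eqP; rewrite -subr_eq0; apply/eqP; exact: K.
Qed.

(** All members of the chain vanish to full order at [z], so by induction the next
one is zero and [f] is a multiple of an exponential that vanishes at [z]. *)
Lemma annihilated_unique s f z : annihilated s f ->
  (forall j : nat, (j < size s)%N -> cderiv j f z = 0) -> forall w, f w = 0.
Proof.
elim: s f => [|a s IH] f; first by case.
move=> annf H; have [holf anns] := annihilated_cons annf.
have K : forall w, Dsub a f w = 0.
  apply: IH => // j js; rewrite cderiv_Dsub; last first.
    by apply: smoothW (annihilated_smooth annf); rewrite /= ltnS ltnW.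
  by rewrite !H ?mulr0 ?subrr // (leq_trans js).
move=> w; rewrite (exponential_solution (Dsub0_line_diff holf K) w z).
by have /= := H 0%N isT; rewrite /cderiv /= => ->; rewrite !mul0r.
Qed.

Lemma zero_order_cderiv m f z : smooth m.+1 f ->
  (forall j : nat, (j < m)%N -> cderiv j f z = 0) -> cderiv m f z != 0 ->
  zero_order f z m.
Proof.
elim: m f => [|m IH] f sm H H0.
  by apply: zero_order0 => //; apply: cdiff_at_ccontinuous; exact: (smooth_cdiff sm).
apply: (zero_orderS (cdiff_line_diff (smooth_cdiff sm))); first exact: (H 0%N).
apply: IH.
- by move=> j jm; rewrite -cderivSr; exact: sm.
- by move=> j jm; rewrite -cderivSr; exact: H.
- by rewrite -cderivSr.
Qed.

Lemma annihilated_zero_order s f z : annihilated s f -> nontrivial f ->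
  exists m, [/\ (m < size s)%N, zero_order f z m, cderiv m f z <> 0 &
    forall j : nat, (j < m)%N -> cderiv j f z = 0].
Proof.
move=> annf [w fw].
have [j Hj] : exists j, (j < size s)%N && (cderiv j f z != 0).
  apply: contrapT => K; apply: fw; apply: (annihilated_unique (z := z) annf) => j js.
  by apply: contrapT => /eqP fj; apply: K; exists j; rewrite js.
case: (ex_minnP (ex_intro (fun j => (j < size s)%N && (cderiv j f z != 0)) j Hj)) => m /andP[ms fm] Hm.
have Hlt i : (i < m)%N -> cderiv i f z = 0.
  move=> im; apply: contrapT => /eqP fi.
  by have := Hm i; rewrite fi (ltn_trans im ms) leqNgt im => /(_ isT).
exists m; split=> //; last exact/eqP.
by apply: zero_order_cderiv => //; apply: smoothW (annihilated_smooth annf).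
Qed.

(** * Solutions as sums of polynomials times exponentials *)

(** For [m <> 0] the formal solution is [p / m - p' / m^2 + p'' / m^3 - ...], which
stops because the degree drops.  For [m = 0] it is a primitive, the only case in
which the degree grows. *)
Lemma poly_ode (m : R[i]) (p : {poly R[i]}) :
  exists2 q : {poly R[i]}, (size q <= size p + (m == 0)%R)%N & q^`() + m *: q = p.
Proof.
have [->|m0] := eqVneq m 0.
  exists (\poly_(j < (size p).+1) (p`_j.-1 / j%:R)).
    by rewrite addn1; exact: size_poly.
  rewrite scale0r addr0; apply/polyP => j; rewrite coef_deriv coef_poly ltnS.
  case: ltnP => [_|pj]; last by rewrite mul0rn nth_default.
  by rewrite /= -[_ *+ j.+1]mulr_natr mulfVK // pnatr_eq0.
rewrite addn0; have [n] := ubnP (size p); elim: n p => // n IH p pn.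
have [->|p0] := eqVneq p 0; first by exists 0; rewrite // deriv0 scaler0 addr0.
have sp' : (size (- m^-1 *: p^`()) < size p)%N.
  rewrite (leq_ltn_trans (size_scale_leq _ _)) // lt_size_deriv //.
have [//|q sq E] := IH (- m^-1 *: p^`()).
  exact: leq_trans sp' pn.
exists (m^-1 *: p + q).
  rewrite (leq_trans (size_polyD _ _)) // geq_max size_scale_leq /=.
  exact: leq_trans sq (ltnW sp').
rewrite derivD derivZ scalerDr scalerA divff // scale1r addrACA E scaleNr.
by rewrite addrAC subrr add0r.
Qed.

Definition expsum r (p : R[i] -> {poly R[i]}) z :=
  \sum_(a <- r) (p a).[z] * cexp a z.

(** The degree of the factor of [exp(a z)] stays below the multiplicity of [a]: solving
[(D - a) f = g] raises the degree in the resonant term only.  For simple roots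
the factors are therefore constants. *)
Lemma annihilated_expsum s r f : uniq r -> {subset s <= r} -> annihilated s f ->
  exists2 p : R[i] -> {poly R[i]}, forall a, (size (p a) <= count_mem a s)%N &
    forall z, f z = expsum r p z.
Proof.
move=> ur; elim: s f => [|a s IH] f sr.
  move=> [_ f0]; exists (fun=> 0) => [b|z]; first by rewrite size_poly0.
  by rewrite f0 /expsum big1 // => b _; rewrite horner0 mul0r.
move=> annf; have [holf anns] := annihilated_cons annf.
have [|p ps pE] := IH _ _ anns.
  by move=> b bs; apply: sr; rewrite inE bs orbT.
have /choice[q qP] : forall b, exists q : {poly R[i]},
    (size q <= size (p b) + (b == a)%R)%N /\ q^`() + (b - a) *: q = p b.
  move=> b; have [q q1 q2] := poly_ode (b - a) (p b); exists q; split=> //.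
  by rewrite -[b == a]subr_eq0.
have Lq : line_diff (expsum r q) (fun z => expsum r p z + a * expsum r q z).
  apply: (line_diff_eq (line_diff_sum r (fun b => line_diffM (@line_diff_poly (q b)) (@line_diff_cexp b)))) => // z.
  rewrite /expsum mulr_sumr -big_split /=; apply: eq_bigr => b _.
  have [_ <-] := qP b; rewrite hornerD hornerZ. ring.
(* Subtract a particular solution of [Dsub a f = expsum r p]. *)
pose d z := f z - expsum r q z.
have Ld : line_diff d (fun z => a * d z).
  apply: (line_diff_eq (line_diffD (cdiff_line_diff holf) (line_diffN Lq))) => // z.
  by rewrite -pE /d /Dsub; ring.
have dE := exponential_solution Ld.
set c := d 0 * cexp (- a) 0 in dE.
exists (fun b => q b + (c *+ (b == a))%:P).
  move=> b; rewrite (leq_trans (size_polyD _ _)) // geq_max /= addnC [a == b]eq_sym.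
  have [qs _] := qP b; apply/andP; split.
    by apply: (leq_trans qs); rewrite leq_add2r.
  have [->|ba] := eqVneq b a; last by rewrite mulr0n polyC0 size_poly0.
  by rewrite (leq_trans (size_polyC_leq1 _)) // addn1.
move=> z; rewrite -[f z](subrK (expsum r q z)) -/(d z) (dE z 0) -/c addrC.
rewrite /expsum; under [RHS]eq_bigr => b _ do rewrite hornerD hornerC mulrDl.
rewrite big_split /=; congr (_ + _).
rewrite (bigD1_seq a) //=; last by apply: sr; rewrite inE eqxx.
rewrite eqxx mulr1n big1 ?addr0 // => b /negbTE ->.
by rewrite mulr0n mul0r.
Qed.

End Chain.

(** * Compactness of rectangles *)

Section Compact.
Variable R : realType.
Implicit Types (f g : R[i] -> R[i]) (z w : R[i]).

Definition rect (x0 x1 y0 y1 : R) : set R[i] :=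
  [set z | x0 <= Re z <= x1 /\ y0 <= Im z <= y1].

Lemma rect_covering (x0 x1 y0 y1 : R) (I : Type) (F : set_system I)
    (P : I -> R[i] -> Prop) : Filter F ->
  (forall z, rect x0 x1 y0 y1 z -> exists2 d : R, 0 < d &
     F [set i | forall w, normc (w - z) < d -> P i w]) ->
  F [set i | forall z, rect x0 x1 y0 y1 z -> P i z].
Proof.
move=> FF H.
have cK : compact (`[x0, x1]%classic `*` `[y0, y1]%classic : set (R * R)).
  by apply: compact_setX; exact: segment_compact.
have /compact_near_coveringP/(_ I F (fun i p => P i (p.1 +i* p.2)) FF) K := cK.
apply: filterS (K _).
  move=> i Hi [a b] [/= ha hb]; apply: (Hi (a, b)).
  by split; rewrite /= in_itv.
move=> [a b] [/=]; rewrite !in_itv /= => ha hb.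
have [d d0 Hd] := H (a +i* b) (conj ha hb).
exists ([set p | normc ((p.1 +i* p.2) - (a +i* b)) < d], [set i | forall w, normc (w - (a +i* b)) < d -> P i w]).
  split=> //=; apply/nbhs_ballP; exists (d / 2) => /=; first exact: divr_gt0.
  move=> [c e] [/=]; rewrite -!ball_normE /ball_ /= => hc he.
  apply: (le_lt_trans (normc_le ((c +i* e) - (a +i* b)))); rewrite /= -[c - a]opprB -[e - b]opprB !normrN; lra.
by move=> [p i] [/= h1 h2]; exact: h2.
Qed.

Lemma rect_uniform (x0 x1 y0 y1 : R) (P : R -> R[i] -> Prop) :
  (forall z, rect x0 x1 y0 y1 z -> exists2 d : R, 0 < d &
     forall w e, normc (w - z) < d -> 0 < e < d -> P e w) ->
  exists2 e : R, 0 < e & forall z, rect x0 x1 y0 y1 z -> P e z.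
Proof.
move=> H; pose F : set_system R := filter_from [set d : R | 0 < d] (fun d => [set e | 0 < e < d]).
have FF : Filter F.
  apply: filter_from_filter; first by exists 1; rewrite /= ltr01.
  move=> a b /= a0 b0; exists (Num.min a b); rewrite /= ?lt_min ?a0 //.
  by move=> e /= /andP[e0]; rewrite lt_min => /andP[-> ->]; rewrite e0.
have [|d /= d0 Hd] := @rect_covering x0 x1 y0 y1 R F P FF.
  by move=> z /H[d d0 Hd]; exists d => //; exists d => //= e ed w wd; exact: Hd.
by exists (d / 2); [exact: divr_gt0 | apply: Hd => /=; lra].
Qed.

(** A covering argument over the filter of the finite lists that contain any given
finite list. *)
Lemma rect_finite (x0 x1 y0 y1 : R) (Q : R[i] -> Prop) :
  (forall z, rect x0 x1 y0 y1 z -> exists2 d : R, 0 < d &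
     forall w, normc (w - z) < d -> Q w -> w = z) ->
  exists l : seq R[i], forall z, rect x0 x1 y0 y1 z -> Q z -> z \in l.
Proof.
move=> H; pose F : set_system (seq R[i]) := filter_from setT (fun s : seq R[i] => [set l : seq R[i] | {subset s <= l}]).
have FF : Filter F.
  apply: filter_from_filter; first by exists [::].
  move=> a b _ _; exists (a ++ b) => // l /= abl.
  by split=> z zs; apply: abl; rewrite mem_cat zs ?orbT.
have [|s _ Hs] := @rect_covering x0 x1 y0 y1 _ F (fun l z => Q z -> z \in l) FF.
  move=> z /H[d d0 Hd]; exists d => //; exists [:: z] => //= l zl w wd Qw.
  by apply: zl; rewrite inE (Hd w).
by exists s; exact: Hs.
Qed.

End Compact.

(** * Dividing out zeros *)

Section Divide.
Variable R : realType.
Implicit Types (f g : R[i] -> R[i]) (z w : R[i]).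

Lemma zero_order_isolated f z m : zero_order f z m ->
  exists2 d : R, 0 < d & forall w, normc (w - z) < d -> f w = 0 -> w = z.
Proof.
move=> [c c0 H]; have nc : 0 < normc c by rewrite normc_gt0.
have [d d0 K] := H (normc c / 2) (divr_gt0 nc (ltr0n _ 2)).
exists d => // w hw fw; apply/eqP; rewrite -subr_eq0 -normc_eq0.
have := K _ hw; rewrite (addrC z) subrK fw sub0r normcN normcM normcX => Kw.
have X0 := exprn_ge0 m (normc_ge0 (w - z)).
have /eqP : normc (w - z) ^+ m = 0 by nra.
by rewrite expf_eq0 => /andP[].
Qed.

Lemma zero_order_eq0 f z m : zero_order f z m -> (f z == 0) = (0 < m)%N.
Proof.
move=> [c c0 H]; apply/idP/idP; last first.
  case: m H => // m H _; have [d d0 K] := H 1 ltr01.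
  have := K 0; rewrite normc0 addr0 !expr0n /= !mulr0 subr0 => /(_ d0).
  by move=> fz; rewrite -normc_eq0 eq_le fz normc_ge0.
case: m H => // H /eqP fz.
have nc : 0 < normc c by rewrite normc_gt0.
have [d d0 K] := H (normc c / 2) (divr_gt0 nc (ltr0n _ 2)).
have := K 0; rewrite normc0 addr0 !expr0 !mulr1 fz sub0r normcN => /(_ d0).
lra.
Qed.

Lemma zero_order_ccontinuous f z m : zero_order f z m -> ccontinuous f z.
Proof.
move=> Hm; have := Hm => -[c c0 H] e e0.
case: m Hm H => [|m] Hm H.
  have [d d0 K] := H (e / 3) (divr_gt0 e0 (ltr0n _ 3)); exists d => // h hd.
  have := K 0; rewrite normc0 addr0 !expr0 !mulr1 => /(_ d0) K0.
  have := K h hd; rewrite !expr0 !mulr1 => Kh.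
  apply: le_lt_trans (ler_normcBD _ _ c) _; rewrite (normcB c); lra.
have fz : f z = 0 by apply/eqP; rewrite (zero_order_eq0 Hm).
have nc := normc_ge0 c.
have [d d0 K] := H 1 ltr01; exists (Num.min (Num.min d 1) (e / (2 + normc c))).
  by rewrite !lt_min d0 ltr01 divr_gt0 //; lra.
move=> h; rewrite !lt_min -andbA => /and3P[/K hd h1 he]; rewrite fz subr0.
rewrite mul1r in hd.
have -> : f (z + h) = f (z + h) - c * h ^+ m.+1 + c * h ^+ m.+1 by rewrite subrK.
apply: le_lt_trans (le_normcD _ _) _; rewrite normcM normcX.
have hn := normc_ge0 h.
have hm : normc h ^+ m.+1 <= normc h.
  by rewrite exprS ler_piMr // exprn_ile1 // ltW.
have : normc h * (2 + normc c) < e by rewrite -ltr_pdivlMr //; lra.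
nra.
Qed.

(** The quotient by [z - z0] has a limit at [z0]; defining it there by its limit
gives a function which again has an order of vanishing everywhere, and hence is
continuous, as needed to divide again and to lift the argument. *)
Lemma zero_order_divide f m z0 : (forall z, zero_order f z (m z)) -> (0 < m z0)%N ->
  exists g, (forall z, f z = (z - z0) * g z) /\
            (forall z, zero_order g z (m z - (z == z0))%N).
Proof.
move=> H m0; have := H z0; case Em : (m z0) m0 => [//|n] _ [c c0 Hc].
pose g z := if z == z0 then (if n is 0%N then c else 0) else f z / (z - z0).
have fz0 : f z0 = 0 by apply/eqP; rewrite (zero_order_eq0 (H z0)) Em.
exists g; split=> z.
  rewrite /g; case: eqVneq => [->|zz]; first by rewrite subrr mul0r fz0.
  by rewrite mulrC divfK // subr_eq0.
have [->|zz] := eqVneq z z0.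
  rewrite Em subn1 /=; exists c => // e e0; have [d d0 K] := Hc e e0; exists d => // h hd.
  rewrite /g -subr_eq0 addrAC subrr add0r.
  have [->|h0] := eqVneq h 0.
    rewrite normc0 /=; case: (n) => [|k].
      by rewrite !expr0 !mulr1 subrr normc0 ltW.
    by rewrite !expr0n /= !mulr0 subrr normc0.
  have -> : f (z0 + h) / h - c * h ^+ n = (f (z0 + h) - c * h ^+ n.+1) / h.
    by rewrite exprS; field.
  rewrite normcM normcV ler_pdivrMr ?normc_gt0 //.
  by apply: le_trans (K h hd) _; rewrite exprS; lra.
rewrite subn0; have [b b0 Hb] := H z; set w := z - z0.
have w0 : w != 0 by rewrite subr_eq0.
have nw : 0 < normc w by rewrite normc_gt0.
(* Away from [z0] the factor [1 / (z - z0)] is nearly the constant [1 / w]. *)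
exists (b / w); first by rewrite mulf_neq0 // invr_neq0.
move=> e e0.
have [d d0 K] := Hb (e * normc w / 4) (divr_gt0 (mulr_gt0 e0 nw) (ltr0n _ 4)).
have nb := normc_ge0 b.
exists (Num.min d (Num.min (normc w / 2) (e * normc w ^+ 2 / (4 * (normc b + 1))))).
  rewrite !lt_min d0 !divr_gt0 // ?mulr_gt0 ?exprn_gt0 //; lra.
move=> h; rewrite !lt_min => /and3P[hd hw].
rewrite ltr_pdivlMr; last by lra.
move=> he.
have wh : normc w / 2 <= normc (w + h).
  have := ler_normcB w (- h); rewrite opprK normcN; lra.
have wh0 : w + h != 0 by rewrite -normc_gt0; apply: lt_le_trans wh; rewrite divr_gt0.
have zh : z + h != z0 by rewrite -subr_eq0 addrAC.
rewrite /g (negbTE zh) (_ : z + h - z0 = w + h); last by rewrite /w addrAC.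
have -> : f (z + h) / (w + h) - b / w * h ^+ m z =
  ((f (z + h) - b * h ^+ m z) - b * h ^+ m z * h / w) / (w + h).
  by field; rewrite wh0 w0.
rewrite normcM normcV ler_pdivrMr ?normc_gt0 //.
apply: le_trans (le_normcD _ _) _; rewrite normcN !normcM normcV normcX.
have Kh := K h hd.
have X0 : 0 <= normc h ^+ m z by rewrite exprn_ge0 // normc_ge0.
have hn := normc_ge0 h.
have : normc b * normc h ^+ m z * normc h / normc w <= e * normc w / 4 * normc h ^+ m z.
  rewrite ler_pdivrMr //.
  have : normc b * normc h <= e * normc w / 4 * normc w.
    have : normc h * (4 * normc b) <= e * normc w ^+ 2 by apply: le_trans (ltW he); rewrite ler_wpM2l //; lra.
    rewrite expr2; lra.
  by move=> /(ler_wpM2r X0); lra.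
have : e * normc h ^+ m z * (normc w / 2) <= e * normc h ^+ m z * normc (w + h).
  by rewrite ler_wpM2l // mulr_ge0 // ltW.
by move: Kh; lra.
Qed.

Lemma zero_order_divide_seq f m (l : seq R[i]) : (forall z, zero_order f z (m z)) ->
  (forall z, (count_mem z l <= m z)%N) ->
  exists g, (forall z, f z = \prod_(a <- l) (z - a) * g z) /\
            (forall z, zero_order g z (m z - count_mem z l)%N).
Proof.
elim: l f m => [|a l IH] f m H Hl.
  by exists f; split=> z; rewrite ?big_nil ?mul1r // subn0.
have [|g1 [E1 H1]] := @zero_order_divide f m a H.
  by apply: leq_trans (Hl a); rewrite /= eqxx.
have [|g [E2 H2]] := IH g1 _ H1.
  move=> z; have := Hl z; rewrite /= eq_sym; case: (z == a) => /=; lia.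
exists g; split=> z; first by rewrite E1 E2 big_cons mulrA.
by have := H2 z; rewrite -subnDA /= [a == z]eq_sym.
Qed.

End Divide.

(** * A continuous argument on a rectangle *)

Section Lift.
Variable R : realType.
Implicit Types (f g : R[i] -> R[i]) (z w : R[i]).

(** The argument of a number of the right half-plane. *)
Definition right_arg (w : R[i]) : R := atan (Im w / Re w).

Lemma right_argP (w : R[i]) : 0 < Re w -> w = (normc w)%:C * cis (right_arg w).
Proof.
move=> w0; rewrite /right_arg; set x := Im w / Re w.
have nE : normc w = Re w * Num.sqrt (1 + x ^+ 2).
  apply/eqP; rewrite -(eqrXn2 (n := 2)) ?normc_ge0 ?mulr_ge0 ?sqrtr_ge0 ?(ltW w0) //.
  rewrite normc_sqr exprMn sqr_sqrtr ?addr_ge0 ?sqr_ge0 // /x.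
  by apply/eqP; field; rewrite gt_eqF.
have q0 : Num.sqrt (1 + x ^+ 2) != 0.
  by rewrite gt_eqF // sqrtr_gt0 ltr_pwDl // sqr_ge0.
have sE : sin (atan x) = x / Num.sqrt (1 + x ^+ 2).
  by rewrite -{2}(atanK x) /tan cos_atan; field.
apply: ReImP; rewrite !ReImE /= mul0r ?subr0 ?addr0 nE ?cos_atan ?sE.
  by rewrite mulfK.
have -> : forall r q : R, q != 0 -> r * q * (x / q) = r * x by move=> r q h; field.
  by rewrite /x mulrC divfK // gt_eqF.
by [].
Qed.

Lemma ratio_Re_gt0 z w : normc (w - z) < normc z -> 0 < Re (w / z).
Proof.
move=> h; have z0 : z != 0.
  by rewrite -normc_gt0; apply: le_lt_trans h; exact: normc_ge0.
have -> : w / z = 1 + (w - z) / z by field.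
have : normc ((w - z) / z) < 1 by rewrite normcM normcV ltr_pdivrMr ?normc_gt0 // mul1r.
move: ((w - z) / z) => v hv; rewrite ReD /=.
have := ler_Re_normc v; rewrite ler_norml => /andP[]; lra.
Qed.

Definition path_continuous (F : R -> R[i]) (s : R) : Prop :=
  {for s, continuous (fun t : R => Re (F t))} /\ {for s, continuous (fun t : R => Im (F t))}.

Lemma continuous_eps (F : R -> R) (s : R) :
  (forall e, 0 < e -> exists2 d, 0 < d & forall h, `|h| < d ->
     `|F (s + h) - F s| < e) -> {for s, continuous F}.
Proof.
move=> H; apply/cvgrPdist_lt => e /H[d d0 K]; apply/nbhs_ballP; exists d => //= t.
rewrite /ball_ /= -normrN opprB => /K; rewrite subrKC.
by rewrite -normrN opprB.
Qed.

Lemma path_continuous_line g z u s : ccontinuous g (z + s%:C * u) -> path_continuous (fun t : R => g (z + t%:C * u)) s.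
Proof.
move=> H.
have K (e : R) : 0 < e -> exists2 d, 0 < d & forall h : R, `|h| < d ->
    normc (g (z + (s + h)%:C * u) - g (z + s%:C * u)) < e.
  move=> /H[d d0 K]; have m0 : 0 < 1 + normc u by have := normc_ge0 u; lra.
  exists (d / (1 + normc u)); first by rewrite divr_gt0.
  move=> h; rewrite ltr_pdivlMr // => hd.
  rewrite rmorphD mulrDl addrA; apply: K; rewrite normcM normcR.
  have := normr_ge0 h; lra.
split; apply: continuous_eps => e /K[d d0 Hd]; exists d => // h /Hd;
  apply: le_lt_trans.
  by apply: le_trans (ler_Re_normc _); rewrite ReD ReN.
by apply: le_trans (ler_Im_normc _); rewrite ImD ImN.
Qed.

Lemma path_continuous_div F G s : path_continuous F s -> path_continuous G s -> G s != 0 ->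
  path_continuous (fun t : R => F t / G t) s.
Proof.
move=> [f1 f2] [g1 g2] Gs.
have n0 : Re (G s) ^+ 2 + Im (G s) ^+ 2 != 0.
  by rewrite -normc_sqr expf_neq0 // normc_eq0.
have cN : {for s, continuous (fun t : R => (Re (G t) ^+ 2 + Im (G t) ^+ 2)^-1)}.
  apply: cvgV => //; apply: cvgD; exact: cvgM.
split.
  rewrite (_ : (fun t => _) = fun t : R => (Re (F t) * Re (G t) + Im (F t) * Im (G t)) * (Re (G t) ^+ 2 + Im (G t) ^+ 2)^-1); last first.
    by apply/funext => t; rewrite ReM ReV ImV; ring.
  by apply: cvgM => //; apply: cvgD; exact: cvgM.
rewrite (_ : (fun t => _) = fun t : R => (Im (F t) * Re (G t) - Re (F t) * Im (G t)) * (Re (G t) ^+ 2 + Im (G t) ^+ 2)^-1); last first.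
  by apply/funext => t; rewrite ImM ReV ImV; ring.
by apply: cvgM => //; apply: cvgB; exact: cvgM.
Qed.

Lemma continuous_right_arg F s : path_continuous F s -> 0 < Re (F s) ->
  {for s, continuous (fun t : R => right_arg (F t))}.
Proof.
move=> [f1 f2] F0; apply: (@continuous_comp _ _ _ (fun t : R => Im (F t) / Re (F t)) atan).
  by apply: cvgM => //; apply: cvgV => //; rewrite gt_eqF.
exact: continuous_atan.
Qed.

Lemma rect_convex (x0 x1 y0 y1 : R) z w (t : R) : 0 <= t <= 1 ->
  rect x0 x1 y0 y1 z -> rect x0 x1 y0 y1 w -> rect x0 x1 y0 y1 (z + t%:C * (w - z)).
Proof.
move=> /andP[t0 t1] [/andP[a1 a2] /andP[b1 b2]] [/andP[c1 c2] /andP[d1 d2]].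
by split; rewrite !ReImE /= mul0r ?subr0 ?addr0; apply/andP; split; nra.
Qed.

(** On a rectangle, which is star-shaped, the argument of [g z] can be written down at
once: go from a fixed corner to [z] in equal steps, so many that [g] turns by
less than a right angle at each step, and add up these turns.  As a finite sum
of continuous functions the result is continuous.  The constant [kappa] is the
phase of [g] at the corner. *)
Lemma argument_lift (x0 x1 y0 y1 : R) g : x0 <= x1 -> y0 <= y1 ->
  (forall z, ccontinuous g z) -> (forall z, rect x0 x1 y0 y1 z -> g z != 0) ->
  exists (th : R[i] -> R) (kappa : R[i]),
    (forall z, rect x0 x1 y0 y1 z -> g z = (normc (g z))%:C * cis (th z) * kappa) /\
    (forall z u s, rect x0 x1 y0 y1 (z + s%:C * u) ->
       {for s, continuous (fun t : R => th (z + t%:C * u))}).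
Proof.
move=> x01 y01 gc g0.
have [d d0 Hd] : exists2 d : R, 0 < d & forall z, rect x0 x1 y0 y1 z ->
    forall w, normc (w - z) < d -> normc (g w - g z) < normc (g z).
  apply: (@rect_uniform _ x0 x1 y0 y1 (fun d z => forall w, normc (w - z) < d -> normc (g w - g z) < normc (g z))).
  move=> z Kz; have nz : 0 < normc (g z) by rewrite normc_gt0 g0.
  have [d d0 Hd] := gc z _ (divr_gt0 nz (ltr0n _ 3)).
  exists (d / 2) => [|w e wz /andP[e0 ed] v vw]; first exact: divr_gt0.
  have h1 := Hd (w - z); rewrite subrKC in h1.
  have h2 := Hd (v - z); rewrite subrKC in h2.
  have vz : normc (v - z) < d by apply: le_lt_trans (ler_normcBD _ _ w) _; lra.
  have dd : d / 2 < d by lra.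
  have {}h1 := h1 (lt_trans wz dd); have {}h2 := h2 vz.
  have := ler_normcBD (g v) (g w) (g z); have := ler_normcB (g z) (g w).
  rewrite (normcB (g z) (g w)); lra.
pose p0 := x0 +i* y0.
have Kp0 : rect x0 x1 y0 y1 p0 by split; rewrite /= lexx.
pose D := (x1 - x0) + (y1 - y0).
(* [D] bounds the length of all rays, so [n.+1] steps are shorter than [d]. *)
have [n Hn] : exists n : nat, D / d < n.+1%:R.
  exists (Num.bound (D / d)); apply: lt_le_trans (_ : (Num.bound (D / d))%:R <= _); last by rewrite ler_nat.
  by apply: archi_boundP; rewrite divr_ge0 ?(ltW d0) // /D; lra.
pose tau l : R := l%:R / n.+1%:R.
pose zt z l := p0 + (tau l)%:C * (z - p0).
have tau01 (l : nat) : (l <= n.+1)%N -> 0 <= tau l <= 1.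
  move=> ln; rewrite /tau divr_ge0 //= ler_pdivrMr // mul1r ler_nat //.
have Kzt z l : (l <= n.+1)%N -> rect x0 x1 y0 y1 z -> rect x0 x1 y0 y1 (zt z l).
  by move=> ln Kz; apply: rect_convex => //; exact: tau01.
have ztn z : zt z n.+1 = z by rewrite /zt /tau divff ?pnatr_eq0 // mul1r subrKC.
have zt0 z : zt z 0 = p0 by rewrite /zt /tau mul0r mul0r addr0.
have ratio z l : (l < n.+1)%N -> rect x0 x1 y0 y1 z -> 0 < Re (g (zt z l.+1) / g (zt z l)).
  move=> ln Kz; apply: ratio_Re_gt0; apply: Hd; first by apply: Kzt => //; exact: ltnW.
  have -> : zt z l.+1 - zt z l = (n.+1%:R^-1)%:C * (z - p0).
    rewrite /zt /tau -natr1 mulrDl mul1r rmorphD; ring.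
  rewrite normcM normcR gtr0_norm ?invr_gt0 // mulrC ltr_pdivrMr //.
  apply: (@le_lt_trans _ _ D); last by rewrite mulrC -ltr_pdivrMr.
  apply: le_trans (normc_le _) _; rewrite /D; move: Kz => [/andP[? ?] /andP[? ?]].
  by rewrite !ReImE /= !ger0_norm; lra.
pose th z := \sum_(l < n.+1) right_arg (g (zt z l.+1) / g (zt z l)).
pose kappa := g p0 / (normc (g p0))%:C.
exists th, kappa; split.
  move=> z Kz.
  suff K l : (l <= n.+1)%N -> g (zt z l) = (normc (g (zt z l)))%:C *
      cis (\sum_(j < l) right_arg (g (zt z j.+1) / g (zt z j))) * kappa.
    by have := K n.+1 (leqnn _); rewrite ztn.
  elim: l => [|l IH] ln.
    rewrite zt0 big_ord0 cis0 mulr1 /kappa mulrC divfK //.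
    by apply/eqP => /complexI/eqP; rewrite normc_eq0; apply/negP; exact: g0.
  have gl0 : g (zt z l) != 0 by apply: g0; apply: Kzt => //; exact: ltnW.
  rewrite big_ord_recr /= cisD; have := ratio _ _ ln Kz.
  set q := g _ / g _; move=> q0.
  have -> : g (zt z l.+1) = q * g (zt z l) by rewrite divfK.
  rewrite normcM rmorphM [in LHS](right_argP q0) [X in _ * X = _](IH (ltnW ln)); ring.
move=> z u s Kz; rewrite /th.
have: forall k : nat, (k <= n.+1)%N -> {for s, continuous (fun t : R => \sum_(l < k) right_arg (g (zt (z + t%:C * u) l.+1) / g (zt (z + t%:C * u) l)))}.
  elim=> [_|k IH kn].
    by rewrite (_ : (fun t => _) = cst 0); [exact: cvg_cst | apply/funext => t; rewrite big_ord0].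
  rewrite (_ : (fun t => _) = (fun t : R => \sum_(l < k) right_arg (g (zt (z + t%:C * u) l.+1) / g (zt (z + t%:C * u) l)) + right_arg (g (zt (z + t%:C * u) k.+1) / g (zt (z + t%:C * u) k)))); last first.
    by apply/funext => t; rewrite big_ord_recr.
  apply: cvgD; first exact: IH (ltnW kn).
  have rl l : path_continuous (fun t : R => g (zt (z + t%:C * u) l)) s.
    rewrite (_ : (fun t => _) = (fun t : R => g ((p0 + (tau l)%:C * (z - p0)) + t%:C * ((tau l)%:C * u)))).
      by apply: path_continuous_line; exact: gc.
    by apply/funext => t; congr g; rewrite /zt; ring.
  apply: continuous_right_arg; last exact: ratio.
  by apply: path_continuous_div => //; apply: g0; apply: Kzt => //; exact: ltnW.
by move=> /(_ n.+1 (leqnn _)).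
Qed.
End Lift.

(** * The argument principle on a rectangle *)

Section Winding.
Variable R : realType.
Implicit Types (f g : R[i] -> R[i]) (z w : R[i]).

Lemma is_derive_continuous (F : R -> R) (s l : R) : is_derive s 1 F l -> {for s, continuous F}.
Proof.
move=> H; apply: differentiable_continuous; apply/derivable1_diffP.
exact: (@ex_derive _ _ _ _ _ _ _ H).
Qed.

Lemma continuous_sum (I : Type) (l : seq I) (F : I -> R -> R) (s : R) :
  (forall i, {for s, continuous (F i)}) ->
  {for s, continuous (fun t => \sum_(i <- l) F i t)}.
Proof.
move=> H; elim: l => [|i l IH].
  by rewrite (_ : (fun t => _) = cst 0); [exact: cvg_cst | apply/funext => t; rewrite big_nil].
rewrite (_ : (fun t => _) = (fun t => F i t + \sum_(j <- l) F j t)); last first.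
  by apply/funext => t; rewrite big_cons.
by apply: cvgD => //; exact: H.
Qed.

Lemma atanV (x : R) : 0 < x -> atan x + atan x^-1 = pi / 2.
Proof.
move=> x0; pose y := pi / 2 - atan x.
have a1 := atan_ltpi2 x.
have a0 : 0 < atan x by rewrite -(@atan0 R); exact: lt_atan.
suff -> : atan x^-1 = y by rewrite /y addrC subrK.
have -> : x^-1 = tan y.
  rewrite /y addrC /tan sinDpihalf cosDpihalf cosN sinN opprK.
  by rewrite -[x in LHS]atanK /tan invf_div.
rewrite tanK // in_itv /=; rewrite /y; apply/andP; split; lra.
Qed.

(** Near [s] the angle [psi t - psi s] is less than a right angle, so it is the
arctangent of the slope of [F t / F s], which can be differentiated. *)
Lemma polar_derive (F : R -> R[i]) (F' kappa : R[i]) (psi : R -> R) (s e : R) :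
  0 < e ->
  (forall t, `|t - s| < e -> F t != 0 /\ F t = (normc (F t))%:C * cis (psi t) * kappa) ->
  {for s, continuous psi} -> path_diff F s F' ->
  is_derive s 1 psi (Im (F' / F s)).
Proof.
move=> e0 HF cpsi dF.
have := HF s; rewrite subrr normr0 => /(_ e0) [Fs0 Es].
have k0 : kappa != 0 by apply/eqP => k0; rewrite Es k0 mulr0 eqxx in Fs0.
have dQ : path_diff (fun t => F t / F s) s (F' / F s).
  by apply: (path_diff_eq (path_diffM dF (path_diff_cst (F s)^-1 s))) => //; rewrite mulr0 addr0.
have [d1 d2] := dQ.
have Q1 : F s / F s = 1 by rewrite divff.
have R1 : Re (F s / F s) != 0 by rewrite Q1 /= oner_neq0.
have dV := (fun h => is_deriveV h d1) R1.
have dI : is_derive s 1 (fun t => Im (F t / F s) / Re (F t / F s)) (Im (F' / F s)).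
  apply: (is_derive_eq (is_deriveM d2 dV)).
  by rewrite Q1 /GRing.scale /= invr1 mul0r add0r mul1r.
have dT := is_derive1_comp (is_derive1_atan _) dI.
have dA : is_derive s 1 (fun t => psi s + right_arg (F t / F s)) (Im (F' / F s)).
  apply: (is_derive_eq (is_deriveD (is_derive_cst (psi s) s 1) dT)).
  by rewrite Q1 /= mul0r expr0n /= addr0 invr1 mul1r add0r.
apply: near_eq_is_derive dA.
have /cvgrPdist_lt /(_ (pi / 2)) := cpsi.
rewrite divr_gt0 ?pi_gt0 // => /(_ isT) /nbhs_ballP[d /= d0 Hd].
apply/nbhs_ballP; exists (Num.min d e) => /=; first by rewrite lt_min d0.
move=> t; rewrite -ball_normE /ball_ /= lt_min => /andP[td te].
have ht := Hd t; rewrite -ball_normE /ball_ /= in ht; have {}ht := ht td; rewrite -normrN opprB in ht.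
have {}te : `|t - s| < e by rewrite -normrN opprB.
have [Ft0 Et] := HF t te.
have ns : normc (F s) != 0 by rewrite normc_eq0.
have q0 : 0 < cos (psi t - psi s).
  by rewrite cos_gt0_pihalf // -ltr_norml.
have EQ : F t / F s = (normc (F t) / normc (F s))%:C * cis (psi t - psi s).
  rewrite [in LHS]Et [in LHS]Es cisD.
  have c1 : cis (psi s) * cis (- psi s) = 1 by rewrite -cisD subrr cis0.
  have cn : cis (psi s) != 0.
    by rewrite -normc_eq0 normc_cis oner_neq0.
  have -> : cis (- psi s) = (cis (psi s))^-1 by rewrite -[LHS](mulKf cn) c1 mulr1.
  have nC : (normc (F s))%:C != 0 by apply/eqP => /complexI/eqP; exact/negP.
  by rewrite rmorphM fmorphV; field; rewrite k0 nC cn.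
rewrite EQ /right_arg !ReImE /= !mul0r subr0 addr0.
have r0 : normc (F t) / normc (F s) != 0.
  by rewrite mulf_neq0 ?invr_neq0 // normc_eq0.
rewrite invfM mulrACA divff // mul1r -/(tan _) tanK ?subrKC //.
by rewrite in_itv /= -ltr_norml.
Qed.

Lemma polar_variation (F F' : R -> R[i]) (kappa : R[i]) (psi W W' : R -> R) (l b : R) :
  0 < l ->
  (forall t, 0 <= t <= l -> F t != 0 /\ F t = (normc (F t))%:C * cis (psi t) * kappa) ->
  (forall t, 0 <= t <= l -> {for t, continuous psi}) ->
  (forall t, 0 <= t <= l -> path_diff F t (F' t)) ->
  (forall t, 0 <= t <= l -> is_derive t 1 W (W' t) /\ Im (F' t / F t) - b <= W' t) ->
  psi l - psi 0 - b * l <= W l - W 0.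
Proof.
move=> l0 HF cpsi dF dW.
have oc t : t \in `]0, l[%R -> 0 <= t <= l.
  by rewrite in_itv /= => /andP[/ltW -> /ltW ->].
pose G t := W t + b * t - psi t.
have dG t : t \in `]0, l[%R -> is_derive t 1 G (W' t + b - Im (F' t / F t)).
  move=> tl; have tl' := oc t tl.
  have dpsi : is_derive t 1 psi (Im (F' t / F t)).
    move: tl; rewrite in_itv /= => /andP[t0 t1].
    apply: (@polar_derive F (F' t) kappa psi t (Num.min t (l - t))).
    - by rewrite lt_min t0 subr_gt0.
    - move=> u; rewrite lt_min !ltr_norml => /andP[/andP[? ?] /andP[? ?]].
      by apply: HF; apply/andP; split; lra.
    - exact: cpsi.
    - exact: dF.
  have [dWt _] := dW t tl'.
  have dbt : is_derive t 1 (fun t => b * t) b.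
    by apply: (is_derive_eq (is_deriveZ b (is_derive_id t 1))); rewrite /GRing.scale /= mulr1.
  exact: (is_deriveB (is_deriveD dWt dbt) dpsi).
have cG : {within `[0, l], continuous G}.
  apply: continuous_in_subspaceT => t; rewrite inE /= in_itv /= => tl.
  apply: cvgB; last exact: cpsi.
  apply: cvgD; last by apply: cvgM; [exact: cvg_cst | exact: cvg_id].
  by have [/is_derive_continuous] := dW t tl.
have [x xl] := MVT l0 dG cG.
have [_ hW] := dW x (oc x xl).
rewrite subr0 /G mulr0 addr0 => E.
have : 0 <= (W' x + b - Im (F' x / F x)) * l by rewrite mulr_ge0 // ?(ltW l0) //; lra.
lra.
Qed.

(** The sides are numbered counterclockwise from the bottom, which is side 0. *)
Definition side_start (x0 x1 y0 y1 : R) (i : nat) : R[i] :=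
  nth 0 [:: x0 +i* y0; x1 +i* y0; x1 +i* y1; x0 +i* y1] i.
Definition side_dir (i : nat) : R[i] := nth 0 [:: 1; 'i; -1; - 'i] i.
Definition side_len (x0 x1 y0 y1 : R) (i : nat) : R :=
  nth 0 [:: x1 - x0; y1 - y0; x1 - x0; y1 - y0] i.

Definition side (x0 x1 y0 y1 : R) (i : nat) (t : R) : R[i] :=
  side_start x0 x1 y0 y1 i + t%:C * side_dir i.

Lemma side_rect (x0 x1 y0 y1 : R) (i : nat) (t : R) : x0 < x1 -> y0 < y1 -> (i < 4)%N ->
  0 <= t <= side_len x0 x1 y0 y1 i -> rect x0 x1 y0 y1 (side x0 x1 y0 y1 i t).
Proof.
move=> x01 y01; rewrite /side /rect.
by case: i => [|[|[|[|//]]]] _; rewrite /side_len /side_start /side_dir /= => /andP[t0 t1];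
  split; rewrite ?ReImE /=; apply/andP; split; lra.
Qed.

Lemma side0 (x0 x1 y0 y1 : R) (i : nat) : side x0 x1 y0 y1 i 0 = side_start x0 x1 y0 y1 i.
Proof. by rewrite /side mul0r addr0. Qed.

Lemma side_end (x0 x1 y0 y1 : R) (i : nat) : (i < 4)%N ->
  side x0 x1 y0 y1 i (side_len x0 x1 y0 y1 i) = side_start x0 x1 y0 y1 (i.+1 %% 4).
Proof.
by case: i => [|[|[|[|//]]]] _; rewrite /side /side_start /side_dir /side_len /=;
  apply: ReImP; rewrite ?ReImE /=; ring.
Qed.

Lemma boundary_closed (x0 x1 y0 y1 : R) (th : R[i] -> R) :
  \sum_(i < 4) (th (side x0 x1 y0 y1 i (side_len x0 x1 y0 y1 i)) -
                th (side x0 x1 y0 y1 i 0)) = 0.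
Proof.
under eq_bigr => i _ do rewrite side0 (side_end _ _ _ _ (ltn_ord i)).
by rewrite !big_ord_recl big_ord0 /= /bump /= -/(modn 1 4); ring.
Qed.

Lemma boundary_closed_linear (x0 x1 y0 y1 : R) (a : R[i]) :
  \sum_(i < 4) Im (side_dir i * a) * side_len x0 x1 y0 y1 i = 0.
Proof.
rewrite !big_ord_recl big_ord0 /side_dir /side_len /= !ReImE /=; ring.
Qed.

Lemma side_dir_neq0 (i : nat) : (i < 4)%N -> side_dir i != 0.
Proof.
by case: i => [|[|[|[|//]]]] _; rewrite /side_dir /= ?oppr_eq0 ?oner_eq0 //;
  apply/eqP => -[]; apply/eqP; rewrite oner_eq0.
Qed.

(** In the frame of side [i], with first axis along the side, [pole_pos] is the
abscissa of [z] and [pole_dist] its distance to the side. *)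
Definition pole_pos (x0 x1 y0 y1 : R) (z : R[i]) (i : nat) : R :=
  nth 0 [:: Re z - x0; Im z - y0; x1 - Re z; y1 - Im z] i.
Definition pole_dist (x0 x1 y0 y1 : R) (z : R[i]) (i : nat) : R :=
  nth 0 [:: Im z - y0; x1 - Re z; y1 - Im z; Re z - x0] i.

Lemma side_pole (x0 x1 y0 y1 : R) z (i : nat) (t : R) : (i < 4)%N ->
  side x0 x1 y0 y1 i t - z =
  side_dir i * - 'i * (pole_dist x0 x1 y0 y1 z i +i* (t - pole_pos x0 x1 y0 y1 z i)).
Proof.
by case: i => [|[|[|[|//]]]] _; 
  rewrite /side /side_start /side_dir /pole_dist /pole_pos [nth _ _ _]/=;
  apply: ReImP; rewrite !ReImE /=; ring.
Qed.

Definition inside (x0 x1 y0 y1 : R) z := x0 < Re z < x1 /\ y0 < Im z < y1.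

Lemma pole_dist_gt0 (x0 x1 y0 y1 : R) z (i : nat) : (i < 4)%N ->
  inside x0 x1 y0 y1 z -> 0 < pole_dist x0 x1 y0 y1 z i.
Proof.
by move=> + [/andP[? ?] /andP[? ?]]; case: i => [|[|[|[|//]]]] _; rewrite /pole_dist /= subr_gt0.
Qed.

Definition pole_arg (x0 x1 y0 y1 : R) (i : nat) (z : R[i]) (t : R) : R :=
  atan ((t - pole_pos x0 x1 y0 y1 z i) / pole_dist x0 x1 y0 y1 z i).

(** Seen from an inner point a side is a straight line at positive distance, along
which the argument is an arctangent; the phase of the frame and the quarter
turn go into [kappa]. *)
Lemma pole_argP (x0 x1 y0 y1 : R) (l : seq R[i]) (i : nat) : (i < 4)%N ->
  (forall z, z \in l -> inside x0 x1 y0 y1 z) ->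
  exists kappa : R[i], forall t,
    \prod_(z <- l) (side x0 x1 y0 y1 i t - z) =
    (normc (\prod_(z <- l) (side x0 x1 y0 y1 i t - z)))%:C *
    cis (\sum_(z <- l) pole_arg x0 x1 y0 y1 i z t) * kappa.
Proof.
move=> i4; elim: l => [|z l IH] Hl.
  exists 1 => t; rewrite !big_nil cis0 normc1; ring.
have [|k kE] := IH; first by move=> w wl; apply: Hl; rewrite inE wl orbT.
exists (side_dir i * - 'i * k) => t; rewrite !big_cons.
have p0 : 0 < pole_dist x0 x1 y0 y1 z i by apply: pole_dist_gt0 => //; apply: Hl; rewrite inE eqxx.
pose v := pole_dist x0 x1 y0 y1 z i +i* (t - pole_pos x0 x1 y0 y1 z i).
have vE : v = (normc v)%:C * cis (pole_arg x0 x1 y0 y1 i z t) := @right_argP _ v p0.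
rewrite side_pole // -/v cisD !normcM !normcN.
have -> : normc (side_dir i) = 1.
  by case: (i) i4 => [|[|[|[|//]]]] _; rewrite /side_dir /= ?normcN /= ?oppr0 ?sqrrN ?expr0n ?expr1n /= ?addr0 ?add0r ?sqrtr1.
have -> : normc ('i : R[i]) = 1 by rewrite /= expr0n expr1n /= add0r sqrtr1.
rewrite !mul1r rmorphM [in LHS]vE [in LHS]kE; ring.
Qed.

(** The eight angles pair up at the four corners into complementary angles. *)
Lemma pole_arg_total (x0 x1 y0 y1 : R) z : inside x0 x1 y0 y1 z ->
  \sum_(i < 4) (pole_arg x0 x1 y0 y1 i z (side_len x0 x1 y0 y1 i) -
                pole_arg x0 x1 y0 y1 i z 0) = 2 * pi.
Proof.
move=> [/andP[h1 h2] /andP[h3 h4]].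
rewrite !big_ord_recl big_ord0 /pole_arg /pole_pos /pole_dist /side_len /=.
rewrite !sub0r !mulNr !atanN !opprK.
have -> : x1 - x0 - (Re z - x0) = x1 - Re z by ring.
have -> : x1 - x0 - (x1 - Re z) = Re z - x0 by ring.
have -> : y1 - y0 - (Im z - y0) = y1 - Im z by ring.
have -> : y1 - y0 - (y1 - Im z) = Im z - y0 by ring.
set A := Re z - x0; set B := x1 - Re z; set C := Im z - y0; set D := y1 - Im z.
have A0 : 0 < A by rewrite subr_gt0.
have B0 : 0 < B by rewrite subr_gt0.
have C0 : 0 < C by rewrite subr_gt0.
have D0 : 0 < D by rewrite subr_gt0.
have := atanV (divr_gt0 A0 C0); have := atanV (divr_gt0 B0 C0).
have := atanV (divr_gt0 A0 D0); have := atanV (divr_gt0 B0 D0).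
rewrite !invf_div; lra.
Qed.

(** When [q = f' / f], the imaginary part is the speed at which the argument of [f]
turns along the side, so the increase of [W i] bounds its variation. *)
Definition majorant (x0 x1 y0 y1 : R) (q : R[i] -> R[i]) (W W' : nat -> R -> R) :=
  forall (i : nat) (t : R), (i < 4)%N -> 0 <= t <= side_len x0 x1 y0 y1 i ->
    is_derive t 1 (W i) (W' i t) /\
    `|Im (side_dir i * q (side x0 x1 y0 y1 i t))| <= W' i t.

Definition increment (x0 x1 y0 y1 : R) (W : nat -> R -> R) : R :=
  \sum_(i < 4) (W i (side_len x0 x1 y0 y1 i) - W i 0).

(** Divide [f] by its zeros.  The quotient has a continuous argument on the whole
rectangle, which returns to its initial value along the boundary, while each zero
contributes [2 pi].  The shift by [a] accounts for a factor [exp(- a z)], whose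
argument also returns to its initial value. *)
Lemma argument_principle (x0 x1 y0 y1 : R) f f' m (zs : seq R[i]) (a : R[i]) W W' :
  x0 < x1 -> y0 < y1 -> line_diff f f' -> (forall z, zero_order f z (m z)) ->
  uniq zs -> (forall z, z \in zs -> inside x0 x1 y0 y1 z) ->
  (forall z, rect x0 x1 y0 y1 z -> f z = 0 -> z \in zs) ->
  majorant x0 x1 y0 y1 (fun z => f' z / f z - a) W W' ->
  2 * pi * (\sum_(z <- zs) m z)%:R <= increment x0 x1 y0 y1 W.
Proof.
move=> x01 y01 dF Hm uz zsin zsall maj.
pose l := flatten [seq nseq (m z) z | z <- zs].
have lin z : z \in l -> z \in zs.
  by move=> /flattenP[s /mapP[w wz ->]] /nseqP[-> _].
have cl z : count_mem z l = if z \in zs then m z else 0%N.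
  rewrite /l; elim: (zs) uz => [|w s IH] //= /andP[ws us].
  rewrite count_cat IH // count_nseq in_cons /= [w == z]eq_sym.
  by have [->|zw] := eqVneq z w; rewrite ?(negbTE ws) ?mul1n ?mul0n ?addn0.
have [|g [fE Hg]] := zero_order_divide_seq (l := l) Hm.
  by move=> z; rewrite cl; case: ifP.
have g0 z : rect x0 x1 y0 y1 z -> g z != 0.
  move=> Kz; rewrite (zero_order_eq0 (Hg z)) cl -leqNgt leqn0 subn_eq0.
  case: ifP => // /negbT zz; rewrite leqn0.
  by rewrite -leqn0 leqNgt -(zero_order_eq0 (Hm z)); apply: contra zz => /eqP; exact: zsall.
have [th [kg [thE thc]]] := argument_lift (ltW x01) (ltW y01) (fun z => zero_order_ccontinuous (Hg z)) g0.
have lins z : z \in l -> inside x0 x1 y0 y1 z by move=> /lin; exact: zsin.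
have l0 (i : nat) : (i < 4)%N -> 0 < side_len x0 x1 y0 y1 i.
  by case: i => [|[|[|[|//]]]] _; rewrite /side_len /= subr_gt0.
pose psi i t := th (side x0 x1 y0 y1 i t) + \sum_(z <- l) pole_arg x0 x1 y0 y1 i z t.
have f0 (i : nat) t : (i < 4)%N -> 0 <= t <= side_len x0 x1 y0 y1 i -> f (side x0 x1 y0 y1 i t) != 0.
  move=> i4 ti; have Kt := side_rect x01 y01 i4 ti.
  apply/eqP => /(zsall _ Kt) /zsin; rewrite /inside /side.
  by case: i i4 ti Kt => [|[|[|[|//]]]] _ _ _;
    rewrite /side_start /side_dir !ReImE /= => -[/andP[? ?] /andP[? ?]]; lra.
have step (i : nat) : (i < 4)%N -> psi i (side_len x0 x1 y0 y1 i) - psi i 0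
    - Im (side_dir i * a) * side_len x0 x1 y0 y1 i <= W i (side_len x0 x1 y0 y1 i) - W i 0.
  move=> i4; have [kp kpE] := pole_argP i4 lins.
  apply: (@polar_variation (fun t => f (side x0 x1 y0 y1 i t))
    (fun t => side_dir i * f' (side x0 x1 y0 y1 i t)) (kg * kp) (psi i) (W i) (W' i)); first exact: l0.
  - move=> t ti; split; first exact: f0.
    rewrite fE normcM rmorphM [in LHS]kpE [in LHS](thE _ (side_rect x01 y01 i4 ti)) /psi cisD; ring.
  - move=> t ti; rewrite /psi; apply: cvgD; first by apply: thc; exact: side_rect.
    apply: continuous_sum => z.
    apply: (@continuous_comp _ _ _ (fun u => (u - pole_pos x0 x1 y0 y1 z i) / pole_dist x0 x1 y0 y1 z i) atan); last exact: continuous_atan.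
    by apply: cvgM; [apply: cvgB; [exact: cvg_id | exact: cvg_cst] | exact: cvg_cst].
  - by move=> t ti; exact: dF.
  - move=> t ti; have [dWt Wt] := maj i t i4 ti; split=> //.
    apply: le_trans Wt; apply: le_trans (ler_norm _).
    by rewrite mulrBr ImD ImN mulrA.
have size_l : (size l)%:R * (2 * pi) = \sum_(i < 4) (\sum_(z <- l) (pole_arg x0 x1 y0 y1 i z (side_len x0 x1 y0 y1 i) - pole_arg x0 x1 y0 y1 i z 0)).
  rewrite exchange_big /= (eq_big_seq (fun=> 2 * pi)); last first.
    by move=> z /lins; exact: pole_arg_total.
  by rewrite big_const_seq count_predT iter_addr_0 mulr_natl.
have -> : (\sum_(z <- zs) m z)%N = size l.
  by rewrite /l size_flatten /shape -map_comp sumnE big_map; apply: eq_bigr => z _ /=; rewrite size_nseq.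
rewrite mulrC size_l.
rewrite /increment; apply: le_trans (_ : \sum_(i < 4) (psi i (side_len x0 x1 y0 y1 i) - psi i 0
    - Im (side_dir i * a) * side_len x0 x1 y0 y1 i) <= _); last first.
  by apply: ler_sum => i _; exact: step.
rewrite sumrB boundary_closed_linear subr0.
under eq_bigr do rewrite sumrB.
under [leRHS]eq_bigr do rewrite /psi opprD addrACA.
by rewrite [leRHS]big_split /= (boundary_closed x0 x1 y0 y1 th) add0r.
Qed.

End Winding.

(** * Rolle's theorem for the variation of the argument *)

Section Rolle.
Variable R : realType.
Implicit Types (f g q : R[i] -> R[i]) (z w : R[i]).

(** Let [p] be the logarithmic derivative of [f] along a side and [w] its argument, the
angle between [f] and its tangent vector.  Exactly, one would use the angle
[arccos (cos w)], whose derivative is [w'] times the sign of [sin w].  The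
parameter [e] smooths the corners of that function: up to a constant and a sign,
[turn e p] is [arccos (cos w / sqrt (1 + e^2))]. *)
Definition turn (e : R) (p : R[i]) : R :=
  atan (Re p / Num.sqrt (Im p ^+ 2 + e ^+ 2 * normc p ^+ 2)).

(** A smooth substitute for the sign of [Im p]. *)
Definition turn_speed (e : R) (p : R[i]) : R :=
  Im p / Num.sqrt (Im p ^+ 2 + e ^+ 2 * normc p ^+ 2).

Lemma turn_denom_gt0 (e : R) (p : R[i]) : 0 < e -> p != 0 ->
  0 < Im p ^+ 2 + e ^+ 2 * normc p ^+ 2.
Proof. by move=> e0 p0; rewrite ltr_wpDl ?sqr_ge0 // mulr_gt0 ?exprn_gt0 ?normc_gt0. Qed.

Lemma is_derive_turn (e : R) (p : R -> R[i]) (p' : R[i]) (s : R) : 0 < e -> p s != 0 ->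
  path_diff p s p' ->
  is_derive s 1 (fun t => turn e (p t)) (- (turn_speed e (p s) * Im (p' / p s))).
Proof.
move=> e0 p0 [d1 d2]; have N0 := turn_denom_gt0 e0 p0.
pose N t := Im (p t) ^+ 2 + e ^+ 2 * normc (p t) ^+ 2.
have dN : is_derive s 1 N (2 * Im (p s) * Im p' + e ^+ 2 * (2 * Re (p s) * Re p' + 2 * Im (p s) * Im p')).
  rewrite /N; under eq_fun do rewrite normc_sqr.
  apply: (is_derive_eq (is_deriveD (is_deriveX 2 d2) (is_deriveZ (e ^+ 2) (is_deriveD (is_deriveX 2 d1) (is_deriveX 2 d2))))).
  by rewrite /GRing.scale /= !expr1; ring.
have S0 : Num.sqrt (N s) != 0 by rewrite gt_eqF // sqrtr_gt0.
have dq := @is_derive1_sqrt _ (N s) N0.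
have dS := is_derive1_comp dq dN.
have dV := (fun h => is_deriveV h dS) S0.
have dI : is_derive s 1 (fun t => Re (p t) / Num.sqrt (N t)) _ := is_deriveM d1 dV.
have dT := is_derive1_comp (is_derive1_atan _) dI.
apply: (is_derive_eq dT).
rewrite /turn_speed -/(N s) ImM ReV ImV /GRing.scale /= /comp.
set S := Num.sqrt (N s) in S0 *.
have S2 : S ^+ 2 = N s by rewrite /S sqr_sqrtr // ltW.
have n0 : Re (p s) ^+ 2 + Im (p s) ^+ 2 != 0.
  by rewrite -normc_sqr expf_neq0 // normc_eq0.
move: S0 S2 n0; rewrite /N normc_sqr.
move: S (Re (p s)) (Im (p s)) (Re p') (Im p') => S X Y X' Y' S0 S2 n0.
have q0 : 1 + e ^+ 2 != 0 by rewrite gt_eqF // ltr_pwDl // sqr_ge0.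
have -> : 1 + (X / S) ^+ 2 = (1 + e ^+ 2) * (X ^+ 2 + Y ^+ 2) / S ^+ 2.
  have -> : 1 + (X / S) ^+ 2 = (S ^+ 2 + X ^+ 2) / S ^+ 2 by field.
  by rewrite S2; congr (_ / _); ring.
have K D : D != 0 -> forall M, (D / S ^+ 2)^-1 * (X * (- S ^- 2 * ((2 * S)^-1 * M)) + S^-1 * X')
    = (X' * S ^+ 2 - X * M / 2) / (S * D).
  by move=> D0 M; field; rewrite S0 D0.
rewrite K ?mulf_neq0 // S2; field; by rewrite S0 n0 q0.
Qed.

Lemma turn_speed_le1 (e : R) (p : R[i]) : `|turn_speed e p| <= 1.
Proof.
rewrite /turn_speed normrM normfV [`|Num.sqrt _|]ger0_norm ?sqrtr_ge0 //.
set N := _ + _.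
have [S0|S0] := eqVneq (Num.sqrt N) 0; first by rewrite S0 invr0 mulr0.
rewrite ler_pdivrMr ?lt_neqAle ?sqrtr_ge0 ?andbT 1?eq_sym // mul1r.
by rewrite -sqrtr_sqr ler_wsqrtr // lerDl mulr_ge0 // sqr_ge0.
Qed.

Lemma turn_speed_Im (e : R) (p : R[i]) : 0 < e -> p != 0 ->
  `|Im p| - e * normc p <= turn_speed e p * Im p.
Proof.
move=> e0 p0; have N0 := turn_denom_gt0 e0 p0; rewrite /turn_speed.
set N := _ + _ in N0 *; set S := Num.sqrt N.
have S0 : 0 < S by rewrite sqrtr_gt0.
have S2 : S ^+ 2 = `|Im p| ^+ 2 + e ^+ 2 * normc p ^+ 2.
  by rewrite /S sqr_sqrtr ?(ltW N0) // real_normK ?num_real.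
have -> : Im p / S * Im p = `|Im p| ^+ 2 / S.
  by rewrite real_normK ?num_real // mulrAC expr2.
have i0 := normr_ge0 (Im p).
have n0 := mulr_ge0 (ltW e0) (normc_ge0 p).
rewrite -exprMn in S2.
rewrite ler_pdivlMr //; move: (e * normc p) n0 S2 => b b0 S2.
have h1 : `|Im p| <= S.
  rewrite -(@ler_pXn2r _ 2) // ?nnegrE ?(ltW S0) // S2 lerDl sqr_ge0 //.
have h2 : S <= `|Im p| + b.
  rewrite -(@ler_pXn2r _ 2) // ?nnegrE ?(ltW S0) ?addr_ge0 // S2 sqrrD; have := mulr_ge0 i0 b0; lra.
nra.
Qed.

(** At a corner the tangent vector turns by a right angle.  In terms of
[w] the claim is [asin (c cos w) + asin (c sin w) <= pi / 2] for some [c < 1]. *)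
Lemma turn_corner (e : R) (p : R[i]) : 0 < e -> p != 0 ->
  turn e p - turn e ('i%C * p) <= pi / 2.
Proof.
move=> e0 p0; have n0 : 0 < e ^+ 2 * normc p ^+ 2 by rewrite mulr_gt0 ?exprn_gt0 ?normc_gt0.
rewrite /turn normcM (_ : normc 'i%C = 1) ?mul1r; last by rewrite /= expr0n expr1n /= add0r sqrtr1.
rewrite !ReImE /= !mul0r !mul1r sub0r add0r mulNr atanN opprK.
move: (e ^+ 2 * _) n0 => a a0; set X := Re p; set Y := Im p.
have SX : 0 < Num.sqrt (X ^+ 2 + a) by rewrite sqrtr_gt0 ltr_wpDl ?sqr_ge0.
have SY : 0 < Num.sqrt (Y ^+ 2 + a) by rewrite sqrtr_gt0 ltr_wpDl ?sqr_ge0.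
have neg (x s : R) : 0 < s -> x <= 0 -> atan (x / s) <= 0.
  move=> s0 x0; rewrite -(@atan0 R); apply: le_atan.
  by rewrite pmulr_lle0 // invr_gt0.
have [X0|X0] := leP X 0.
  have := neg _ _ SY X0; have := atan_ltpi2 (Y / Num.sqrt (X ^+ 2 + a)); lra.
have [Y0|Y0] := leP Y 0.
  have := neg _ _ SX Y0; have := atan_ltpi2 (X / Num.sqrt (Y ^+ 2 + a)); lra.
have := atanV (divr_gt0 X0 SY); rewrite invf_div => <-; rewrite lerD2l; apply: le_atan.
rewrite ler_pdivrMr // mulrAC ler_pdivlMr //.
have h1 : Y <= Num.sqrt (Y ^+ 2 + a).
  by rewrite -{1}[Y]gtr0_norm // -sqrtr_sqr ler_wsqrtr // lerDl ltW.
have h2 : X <= Num.sqrt (X ^+ 2 + a).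
  by rewrite -{1}[X]gtr0_norm // -sqrtr_sqr ler_wsqrtr // lerDl ltW.
by rewrite ler_pM // ltW.
Qed.

Lemma path_continuous_bounded (F : R -> R[i]) (l : R) : 0 <= l ->
  (forall t, 0 <= t <= l -> path_continuous F t) ->
  exists2 C : R, 0 <= C & forall t, 0 <= t <= l -> normc (F t) <= C.
Proof.
move=> l0 H.
have cG : {within `[0, l], continuous (fun t => `|Re (F t)| + `|Im (F t)|)}.
  apply: continuous_in_subspaceT => t; rewrite inE /= in_itv /= => tl.
  have [h1 h2] := H t tl; apply: cvgD.
    exact: (cvg_norm h1).
  exact: (cvg_norm h2).
have [c cl cM] := EVT_max l0 cG.
exists (`|Re (F c)| + `|Im (F c)|); first by rewrite addr_ge0.
move=> t tl; apply: le_trans (normc_le _) _.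
by apply: cM; rewrite in_itv.
Qed.

Lemma path_diff_continuous (F : R -> R[i]) s l : path_diff F s l -> path_continuous F s.
Proof. by move=> [/is_derive_continuous h1 /is_derive_continuous h2]. Qed.

Section Rect.
Variables x0 x1 y0 y1 : R.
Hypotheses (x01 : x0 < x1) (y01 : y0 < y1).

Notation sd := (side x0 x1 y0 y1).
Notation sl := (side_len x0 x1 y0 y1).

Definition boundary : set R[i] :=
  [set z | exists (i : nat) (t : R), [/\ (i < 4)%N, 0 <= t <= sl i & z = sd i t]].

Definition perimeter : R := 2 * ((x1 - x0) + (y1 - y0)).

(** With [q = f' / f] this says that the total variation of the argument of [f] along
the boundary is at most [B]; the slack [e] absorbs the smoothing in [turn]. *)
Definition arg_var_le q (B : R) : Prop := forall e : R, 0 < e ->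
  exists W W', majorant x0 x1 y0 y1 q W W' /\ increment x0 x1 y0 y1 W <= B + e.

Lemma side_len_gt0 (i : nat) : (i < 4)%N -> 0 < sl i.
Proof. by case: i => [|[|[|[|//]]]] _; rewrite /side_len /= subr_gt0. Qed.

Lemma sum_side_len (c : R) : \sum_(i < 4) c * sl i = c * perimeter.
Proof. by rewrite !big_ord_recl big_ord0 /side_len /perimeter /=; ring. Qed.

Lemma arg_var_eq q1 q2 (B1 B2 : R) : B1 <= B2 ->
  (forall z, boundary z -> q1 z = q2 z) -> arg_var_le q1 B1 -> arg_var_le q2 B2.
Proof.
move=> B12 E H e /H[W [W' [maj inc]]]; exists W, W'; split; last by apply: le_trans inc _; rewrite lerD2r.
move=> i t i4 ti; rewrite -E; last by exists i, t.
exact: maj.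
Qed.

Lemma arg_var0 : arg_var_le (fun=> 0) 0.
Proof.
move=> e e0; exists (fun _ _ => 0), (fun _ _ => 0); split.
  by move=> i t _ _; split; [exact: is_derive_cst | rewrite mulr0 normr0].
rewrite /increment big1; last by move=> i _; rewrite subrr.
by rewrite add0r ltW.
Qed.

(** Multiplying by an exponential changes the speed of the argument by at most the
modulus of the exponent. *)
Lemma arg_var_shift q (a b : R[i]) (B : R) :
  arg_var_le (fun z => q z - b) B ->
  arg_var_le (fun z => q z - a) (B + normc (b - a) * perimeter).
Proof.
move=> H e /H[W [W' [maj inc]]].
exists (fun i t => W i t + normc (b - a) * t), (fun i t => W' i t + normc (b - a)); split.
  move=> i t i4 ti; have [dW hW] := maj i t i4 ti; split.
    apply: (is_derive_eq (is_deriveD dW (is_deriveZ (normc (b - a)) (is_derive_id t 1)))).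
    by rewrite /GRing.scale /= mulr1.
  have -> : q (sd i t) - a = (q (sd i t) - b) + (b - a) by ring.
  rewrite mulrDr ImD; apply: le_trans (ler_normD _ _) _; apply: lerD => //.
  apply: le_trans (ler_Im_normc _) _; rewrite normcM.
  by case: (i) i4 => [|[|[|[|//]]]] _; rewrite /side_dir /= ?normcN /= ?oppr0 ?sqrrN ?expr0n ?expr1n /= ?addr0 ?add0r ?sqrtr1 mul1r.
rewrite /increment; under eq_bigr do rewrite mulr0 addr0 addrAC.
by rewrite big_split /= sum_side_len addrAC lerD2r.
Qed.

(** Put [F = exp(- a z) f], so that [g / f] and [g' / g - a] are the logarithmic
derivatives of [F] and of [F'].  Let [w] be the angle from [F] to its tangent
vector.  The argument of the tangent vector is that of [F] plus [w], and the
argument of [F] increases exactly when [sin w > 0].  So the speed of the argument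
of [F], taken in absolute value, is at most the one for the tangent vector minus
the derivative of the unsigned angle [|w|].  Over the closed boundary [|w|]
returns to its initial value except for its jumps at the four corners, each at
most a right angle. *)
Lemma arg_var_rolle f f' g g' (a : R[i]) (B : R) :
  line_diff f f' -> line_diff g g' -> (forall z, g z = f' z - a * f z) ->
  (forall z, boundary z -> f z != 0) -> (forall z, boundary z -> g z != 0) ->
  arg_var_le (fun z => g' z / g z - a) B ->
  arg_var_le (fun z => g z / f z) (B + 2 * pi).
Proof.
move=> df dg gE f0 g0 H e e0.
pose p i t := side_dir R i * (g (sd i t) / f (sd i t)).
pose v i t := side_dir R i * (g' (sd i t) / g (sd i t) - f' (sd i t) / f (sd i t)).
have bd (i : nat) t : (i < 4)%N -> 0 <= t <= sl i -> boundary (sd i t).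
  by move=> i4 ti; exists i, t.
have p0 (i : nat) t : (i < 4)%N -> 0 <= t <= sl i -> p i t != 0.
  move=> i4 ti; have b := bd i t i4 ti.
  by rewrite !mulf_neq0 ?invr_neq0 ?side_dir_neq0 ?f0 ?g0.
have dp (i : nat) t : (i < 4)%N -> 0 <= t <= sl i -> path_diff (p i) t (v i t * p i t).
  move=> i4 ti; have b := bd i t i4 ti; have fn := f0 _ b; have gn := g0 _ b.
  have dgs : path_diff (fun t => g (sd i t)) t (side_dir R i * g' (sd i t)) := dg _ _ _.
  have dfs : path_diff (fun t => f (sd i t)) t (side_dir R i * f' (sd i t)) := df _ _ _.
  apply: (path_diff_eq (path_diffM (path_diff_cst (side_dir R i) t) (path_diffM dgs (path_diffV dfs fn)))) => //.
  by rewrite /v /p; field; rewrite fn gn.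
have [C C0 HC] : exists2 C : R, 0 <= C & forall (i : nat) t, (i < 4)%N -> 0 <= t <= sl i -> normc (p i t) <= C.
  have K (i : nat) : (i < 4)%N -> exists2 C : R, 0 <= C & forall t, 0 <= t <= sl i -> normc (p i t) <= C.
    move=> i4; apply: path_continuous_bounded; first exact: ltW (side_len_gt0 i4).
    by move=> t ti; apply: path_diff_continuous; exact: dp.
  have [C0 c0 h0] := K 0%N isT; have [C1 c1 h1] := K 1%N isT.
  have [C2 c2 h2] := K 2%N isT; have [C3 c3 h3] := K 3%N isT.
  exists (C0 + C1 + C2 + C3); first by rewrite !addr_ge0.
  move=> i t; case: i => [|[|[|[|//]]]] _ ti.
  - by have := h0 t ti; lra.
  - by have := h1 t ti; lra.
  - by have := h2 t ti; lra.
  - by have := h3 t ti; lra.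
have P0 : 0 < perimeter by rewrite /perimeter mulr_gt0 // addr_gt0 // subr_gt0.
have [W [W' [maj inc]]] := H (e / 2) (divr_gt0 e0 (ltr0n _ 2)).
pose eta := e / (2 * (C + 1) * perimeter).
have C1 : 0 < C + 1 by rewrite ltr_wpDl.
(* Replacing a sign by [turn_speed] costs at most [eta * C] per unit of length,
   hence less than [e / 2] in total. *)
have eta0 : 0 < eta by rewrite divr_gt0 // mulr_gt0 // mulr_gt0.
exists (fun i t => W i t + turn eta (p i t) + eta * C * t),
  (fun i t => W' i t - turn_speed eta (p i t) * Im (v i t) + eta * C); split.
  move=> i t i4 ti; have [dW hW] := maj i t i4 ti; have pn := p0 i t i4 ti.
  split.
    have dT := is_derive_turn eta0 pn (dp i t i4 ti).
    apply: (is_derive_eq (is_deriveD (is_deriveD dW dT) (is_deriveZ (eta * C) (is_derive_id t 1)))).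
    by rewrite mulfK // /GRing.scale /= mulr1.
  (* The speed for the tangent vector is the sum of the speed of the angle and of
     the speed for [F]. *)
  have hvp : side_dir R i * (g' (sd i t) / g (sd i t) - a) = v i t + p i t.
    have b := bd i t i4 ti; have fn := f0 _ b; have gn := g0 _ b.
    rewrite /v /p [X in _ = _ + _ * (X / _)]gE; field; by rewrite fn gn.
  rewrite hvp ImD in hW.
  have h1 := turn_speed_Im eta0 pn; have h2 := turn_speed_le1 eta (p i t).
  have h3 : eta * normc (p i t) <= eta * C by rewrite ler_pM2l // HC.
  have h4 : turn_speed eta (p i t) * (Im (v i t) + Im (p i t)) <= `|Im (v i t) + Im (p i t)|.
    apply: le_trans (ler_norm _) _; rewrite normrM ler_piMl //.
  rewrite -/(p i t); lra.
have tC : \sum_(i < 4) (turn eta (p i (sl i)) - turn eta (p i 0)) <= 2 * pi.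
  have [q qE] : exists q, forall z, g z / f z = q z by exists (fun z => g z / f z).
  pose c (i : nat) := side_start x0 x1 y0 y1 i.
  have pE (i : nat) : (i < 4)%N -> p i (sl i) = side_dir R i * q (c (i.+1 %% 4)%N).
    by move=> i4; rewrite /p (side_end _ _ _ _ i4) qE.
  have pS (i : nat) : p i 0 = side_dir R i * q (c i) by rewrite /p side0 qE.
  have corner (i : nat) : (i < 4)%N -> turn eta (p i (sl i)) - turn eta (p (i.+1 %% 4)%N 0) <= pi / 2.
    move=> i4; have -> : p (i.+1 %% 4)%N 0 = 'i%C * p i (sl i).
      rewrite pS (pE _ i4) mulrA; congr (_ * _).
      by case: (i) i4 => [|[|[|[|//]]]] _; rewrite /side_dir /modn /=; apply: ReImP; rewrite ?ReImE /=; ring.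
    apply: turn_corner => //; apply: p0 => //.
    by rewrite lexx andbT ltW // side_len_gt0.
  have := corner 0%N isT; have := corner 1%N isT; have := corner 2%N isT; have := corner 3%N isT.
  rewrite !big_ord_recl big_ord0 /bump /= /modn /=; lra.
rewrite /increment; apply: le_trans (_ : increment x0 x1 y0 y1 W + 2 * pi + eta * C * perimeter <= _).
  rewrite -sum_side_len /increment.
  apply: le_trans (lerD (lerD (lexx _) tC) (lexx _)).
  rewrite -!big_split /=; apply: ler_sum => i _; rewrite mulr0 addr0; lra.
have : eta * C * perimeter <= e / 2.
  have -> : eta * C * perimeter = e / 2 * (C / (C + 1)).
    by rewrite /eta; field; rewrite gt_eqF //= gt_eqF //; lra.
  rewrite ler_piMr //; first by lra.
  by rewrite ler_pdivrMr; lra.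
lra.
Qed.

End Rect.
End Rolle.

(** * Zeros of solutions in a rectangle *)

Section Count.
Variable R : realType.
Implicit Types (f g q : R[i] -> R[i]) (z w : R[i]) (s : seq R[i]).

(** On a boundary this makes the logarithmic derivatives of the chain available, up to
the point where the chain becomes identically zero. *)
Fixpoint avoids (D : set R[i]) s f : Prop :=
  (nontrivial f -> forall z, D z -> f z != 0) /\
  if s is a :: s' then avoids D s' (Dsub a f) else True.

Lemma avoids_sub (D E : set R[i]) s f : D `<=` E -> avoids E s f -> avoids D s f.
Proof.
move=> DE; elim: s f => [|a s IH] f [H1 H2]; split=> //.
- by move=> nf z /DE; exact: H1.
- by move=> nf z /DE; exact: H1.
- exact: IH.
Qed.

Lemma annihilated_zeros_finite (x0 x1 y0 y1 : R) s f : annihilated s f -> nontrivial f ->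
  exists l : seq R[i], forall z, rect x0 x1 y0 y1 z -> f z = 0 -> z \in l.
Proof.
move=> annf nf; apply: rect_finite => z _.
by have [m [_ /zero_order_isolated]] := annihilated_zero_order z annf nf.
Qed.

Lemma chain_zeros_finite (x0 x1 y0 y1 : R) s f : annihilated s f ->
  exists l : seq R[i], avoids [set z | rect x0 x1 y0 y1 z /\ z \notin l] s f.
Proof.
elim: s f => [|a s IH] f annf.
  by exists [::]; split=> // -[z]; case: annf => _ ->.
have [_ anns] := annihilated_cons annf; have [l Hl] := IH _ anns.
have [nf|nf] := pselect (nontrivial f); last first.
  by exists l; split.
have [l' Hl'] := annihilated_zeros_finite x0 x1 y0 y1 annf nf.
exists (l ++ l'); split.
  move=> _ z [Kz]; rewrite mem_cat negb_or => /andP[_]; apply: contra => /eqP.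
  exact: Hl'.
apply: avoids_sub Hl => z [Kz]; rewrite mem_cat negb_or => /andP[zl _].
by split.
Qed.

Lemma polyline_length_ge0 (b : R[i]) (t : seq R[i]) : 0 <= polyline_length b t.
Proof. by elim: t b => [|c t IH] b //=; rewrite addr_ge0 // normc_ge0. Qed.

Lemma leq_sum_subset (T : eqType) (A B : seq T) (m : T -> nat) : uniq A -> uniq B ->
  {subset A <= B} -> (\sum_(x <- A) m x <= \sum_(x <- B) m x)%N.
Proof.
move=> uA uB AB; rewrite [leqRHS](bigID (mem A)) /= -[in leqRHS]big_filter.
rewrite (perm_big [seq x <- B | x \in A]) ?leq_addr //.
apply: uniq_perm => //; first exact: filter_uniq.
by move=> x; rewrite mem_filter; have [xA|] := boolP (x \in A); rewrite ?(AB x xA).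
Qed.

Lemma pick_outside (l : seq R) (a b : R) : a < b -> exists2 c, a < c < b & c \notin l.
Proof.
elim: l a b => [|x l IH] a b ab.
  by exists ((a + b) / 2) => //; apply/andP; split; lra.
have [c /andP[ac cb] cl] := IH _ _ ab.
have [xc|xc] := eqVneq c x; last by exists c; rewrite ?inE ?negb_or ?xc ?ac.
have [d /andP[ad dc] dl] := IH _ _ ac.
exists d; first by rewrite ad (lt_trans dc).
by rewrite inE negb_or dl andbT -xc lt_eqF.
Qed.

(** Descend along the chain.  It ends at a function annihilated by [D - a], that is at
a multiple of [exp(a z)], for which the variation is zero after the shift by [a];
this may happen early, when some member of the chain is identically zero. *)
Lemma chain_arg_var (x0 x1 y0 y1 : R) s (a : R[i]) f : x0 < x1 -> y0 < y1 ->
  annihilated (a :: s) f -> nontrivial f ->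
  avoids (boundary x0 x1 y0 y1) (a :: s) f ->
  arg_var_le x0 x1 y0 y1 (fun z => cderiv 1 f z / f z - a)
    (2 * pi * (size s)%:R + polyline_length a s * perimeter x0 x1 y0 y1).
Proof.
move=> x01 y01; have P0 : 0 <= perimeter x0 x1 y0 y1.
  by rewrite /perimeter mulr_ge0 // addr_ge0 // subr_ge0 ltW.
have L0 := polyline_length_ge0.
elim: s a f => [|b s IH] a f annf nf av.
  have [_ [_ K]] := annihilated_cons annf; have [f0 _] := av.
  apply: arg_var_eq (arg_var0 x0 x1 y0 y1); first by rewrite mulr0 add0r mul0r.
  move=> z bz; have fz := f0 nf z bz; have := K z; rewrite /Dsub => /eqP.
  by rewrite subr_eq0 => /eqP ->; rewrite mulfK ?subrr.
have [holf anns] := annihilated_cons annf; have [f0 avs] := av.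
have [ng|ng] := pselect (nontrivial (Dsub a f)); last first.
  apply: arg_var_eq (arg_var0 x0 x1 y0 y1).
    by apply: addr_ge0; apply: mulr_ge0; rewrite ?(mulr_ge0 (ler0n _ 2) (pi_ge0 R)) ?L0 ?ler0n.
  move=> z bz; have fz := f0 nf z bz.
  have : Dsub a f z = 0 by apply: contrapT => h; apply: ng; exists z.
  by rewrite /Dsub => /eqP; rewrite subr_eq0 => /eqP ->; rewrite mulfK ?subrr.
have [g0 _] := avs; have [holg _] := annihilated_cons anns.
have := arg_var_rolle x01 y01 (cdiff_line_diff holf) (cdiff_line_diff holg) (fun=> erefl)
  (f0 nf) (g0 ng) (arg_var_shift a (IH _ _ anns ng avs)).
apply: arg_var_eq; last first.
  by move=> z bz; have fz := f0 nf z bz; rewrite /Dsub; field.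
rewrite [size _]/= -[X in _ <= _ * X + _]natr1 [polyline_length a _]/= normcB; lra.
Qed.

Lemma boundary_inside (x0 x1 y0 y1 : R) z : x0 < x1 -> y0 < y1 ->
  rect x0 x1 y0 y1 z -> ~ boundary x0 x1 y0 y1 z -> inside x0 x1 y0 y1 z.
Proof.
move=> x01 y01 [/andP[a1 a2] /andP[b1 b2]] nb; rewrite /inside.
have [e|n1] := eqVneq (Im z) y0.
  exfalso; apply: nb; exists 0%N, (Re z - x0); split=> //.
    by rewrite /side_len /= subr_ge0 a1 lerD2r.
  by apply: ReImP; rewrite /side /side_start /side_dir ?ReImE /= ?e; ring.
have [e|n2] := eqVneq (Re z) x1.
  exfalso; apply: nb; exists 1%N, (Im z - y0); split=> //.
    by rewrite /side_len /= subr_ge0 b1 lerD2r.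
  by apply: ReImP; rewrite /side /side_start /side_dir ?ReImE /= ?e; ring.
have [e|n3] := eqVneq (Im z) y1.
  exfalso; apply: nb; exists 2%N, (x1 - Re z); split=> //.
    by rewrite /side_len /= subr_ge0 a2 lerD2l lerN2.
  by apply: ReImP; rewrite /side /side_start /side_dir ?ReImE /= ?e; ring.
have [e|n4] := eqVneq (Re z) x0.
  exfalso; apply: nb; exists 3%N, (y1 - Im z); split=> //.
    by rewrite /side_len /= subr_ge0 b2 lerD2l lerN2.
  by apply: ReImP; rewrite /side /side_start /side_dir ?ReImE /= ?e; ring.
by rewrite !lt_neqAle a1 a2 b1 b2 n2 n3 !andbT eq_sym n4 eq_sym n1.
Qed.

Lemma boundary_edge (x0 x1 y0 y1 : R) z : boundary x0 x1 y0 y1 z ->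
  Re z \in [:: x0; x1] \/ Im z \in [:: y0; y1].
Proof.
move=> [i [t [i4 _ ->]]]; case: i i4 => [|[|[|[|//]]]] _;
  rewrite /side /side_start /side_dir !ReImE /= !inE.
- by right; rewrite !mulr0 mul0r !addr0 eqxx.
- by left; rewrite !mulr0 mul0r subrr addr0 eqxx orbT.
- by right; rewrite oppr0 !mulr0 mul0r !addr0 eqxx orbT.
- by left; rewrite oppr0 !mulr0 mul0r subrr addr0 eqxx.
Qed.

(** The rectangle is enlarged slightly in order to keep its boundary away from the
finitely many zeros of all functions of the chain; the resulting error tends
to zero. *)
Lemma zeros_in_rect (x0 x1 y0 y1 : R) s (a : R[i]) f m (F : seq R[i]) :
  x0 <= x1 -> y0 <= y1 -> annihilated (a :: s) f -> nontrivial f ->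
  (forall z, zero_order f z (m z)) -> uniq F -> (forall z, z \in F -> rect x0 x1 y0 y1 z) ->
  2 * pi * (\sum_(z <- F) m z)%:R <=
  2 * pi * (size s)%:R + polyline_length a s * perimeter x0 x1 y0 y1.
Proof.
move=> x01 y01 annf nf Hm uF HF; set L := polyline_length a s.
have L0 : 0 <= L.
  exact: polyline_length_ge0.
apply/ler_addgt0Pr => e e0.
pose h := e / (2 * (8 * L + 1)).
(* Moving each side by at most [h] adds at most [8 h] to the perimeter. *)
have h0 : 0 < h by rewrite divr_gt0 // mulr_gt0 //; lra.
have [l Hl] := chain_zeros_finite (x0 - h) (x1 + h) (y0 - h) (y1 + h) annf.
have [X0 /andP[? ?] lX0] := @pick_outside (map (@Re R) l) (x0 - h) x0 ltac:(lra).
have [X1 /andP[? ?] lX1] := @pick_outside (map (@Re R) l) x1 (x1 + h) ltac:(lra).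
have [Y0 /andP[? ?] lY0] := @pick_outside (map (@Im R) l) (y0 - h) y0 ltac:(lra).
have [Y1 /andP[? ?] lY1] := @pick_outside (map (@Im R) l) y1 (y1 + h) ltac:(lra).
have X01 : X0 < X1 by lra.
have Y01 : Y0 < Y1 by lra.
have av : avoids (boundary X0 X1 Y0 Y1) (a :: s) f.
  apply: avoids_sub Hl => z bz; split.
    have [i [t [i4 ti ->]]] := bz; have := side_rect X01 Y01 i4 ti.
    move=> [/andP[? ?] /andP[? ?]]; split; apply/andP; split; lra.
  apply/negP => zl; have := map_f (@Re R) zl; have := map_f (@Im R) zl.
  have [] := boundary_edge bz; rewrite !inE => /orP[] /eqP ->.
  - by move=> _; apply/negP.
  - by move=> _; apply/negP.
  - by move=> h1 _; move: h1; apply/negP.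
  - by move=> h1 _; move: h1; apply/negP.
have [l' Hl'] := annihilated_zeros_finite X0 X1 Y0 Y1 annf nf.
pose zs := undup [seq z <- F ++ l' | `[< rect X0 X1 Y0 Y1 z /\ f z = 0 >]].
have zsP z : z \in zs -> rect X0 X1 Y0 Y1 z /\ f z = 0.
  by rewrite mem_undup mem_filter => /andP[/asboolP].
have [f0 _] := av.
have [W [W' [maj inc]]] := chain_arg_var X01 Y01 annf nf av (divr_gt0 e0 (ltr0n _ 2)).
have [holf _] := annihilated_cons annf.
have AP := @argument_principle R X0 X1 Y0 Y1 f _ m zs a W W' X01 Y01 (cdiff_line_diff holf) Hm.
have {}AP : 2 * pi * (\sum_(z <- zs) m z)%:R <= increment X0 X1 Y0 Y1 W.
  apply: AP => //; first exact: undup_uniq.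
    move=> z /zsP[Kz fz]; apply: boundary_inside => //.
    by move=> bz; have := f0 nf z bz; rewrite fz eqxx.
  move=> z Kz fz; rewrite mem_undup mem_filter mem_cat (Hl' z Kz fz) orbT andbT.
  exact/asboolP.
have FS : (\sum_(z <- F) m z <= \sum_(z <- zs) m z)%N.
  rewrite (bigID (fun z => f z == 0)) /= [X in (_ + X)%N]big1 ?addn0; last first.
    by move=> z; rewrite (zero_order_eq0 (Hm z)) lt0n negbK => /eqP.
  rewrite -big_filter; apply: leq_sum_subset; rewrite ?filter_uniq ?undup_uniq //.
  move=> z; rewrite mem_filter => /andP[/eqP fz zF].
  rewrite mem_undup mem_filter mem_cat zF andbT; apply/asboolP; split=> //.
  by have [/andP[? ?] /andP[? ?]] := HF z zF; split; apply/andP; split; lra.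
have h1 : 2 * pi * (\sum_(z <- F) m z)%:R <= 2 * pi * (\sum_(z <- zs) m z)%:R :> R.
  by rewrite ler_wpM2l ?ler_nat // mulr_ge0 // (pi_ge0 R).
have h2 : L * perimeter X0 X1 Y0 Y1 <= L * perimeter x0 x1 y0 y1 + L * (8 * h).
  rewrite -mulrDr ler_wpM2l // /perimeter; lra.
have h3 : L * (8 * h) <= e / 2.
  have -> : L * (8 * h) = e / 2 * (8 * L / (8 * L + 1)) by rewrite /h; field; rewrite gt_eqF //; lra.
  rewrite ler_piMr //; first by lra.
  by rewrite ler_pdivrMr; lra.
rewrite -/L in inc; lra.
Qed.

End Count.

(** * Polygonal paths through given points *)

Section Path.
Variable R : realType.
Implicit Types (v w z : R[i]) (s S l : seq R[i]).

Lemma exists_min_seq (T : eqType) (F : T -> R) (x : T) (S : seq T) : x \in S ->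
  exists2 p, p \in S & forall z : T, z \in S -> F p <= F z.
Proof.
elim: S x => // y [|y' S] IH x _.
  by exists y; rewrite ?inE // => z; rewrite inE => /eqP ->.
have [p pS Hp] := IH y' (mem_head _ _).
have [h|/ltW h] := leP (F y) (F p).
  exists y; rewrite ?mem_head // => z; rewrite inE => /orP[/eqP -> //|/Hp].
  exact: le_trans.
exists p; first by rewrite inE pS orbT.
by move=> z; rewrite inE => /orP[/eqP -> //|/Hp].
Qed.

Lemma polyline_length_detour v w l :
  polyline_length v l <= normc (w - v) + polyline_length w l.
Proof.
case: l => [|z l] /=; first by rewrite addr0 normc_ge0.
rewrite addrA lerD2r; apply: le_trans (ler_normcBD _ _ w) _.
by rewrite addrC.
Qed.

(** On a segment from [v] the distance to [v] orders the points. *)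
Lemma segment_suffix v w p z : segment v w p -> segment v w z ->
  normc (p - v) <= normc (z - v) -> segment p w z.
Proof.
move=> [t /= /andP[t0 t1] <-] [u /= /andP[u0 u1] <-].
rewrite ![v + _ - v]addrAC subrr !add0r !normcM !normcR !ger0_norm //.
have [d0|d0] := eqVneq (w - v) 0.
  by move=> _; exists 0; rewrite /= ?lexx ?ler01 // d0 !mulr0 mul0r !addr0.
rewrite ler_pM2r ?normc_gt0 // => tu.
have [te|tn] := eqVneq t 1.
  have ue : u = 1 by apply/eqP; rewrite eq_le u1 -te.
  exists 0; rewrite /= ?lexx ?ler01 // te ue mul0r addr0 //.
have t1' : 0 < 1 - t by rewrite subr_gt0 lt_neqAle tn.
exists ((u - t) / (1 - t)).
  by rewrite /= divr_ge0 ?subr_ge0 //= ler_pdivrMr // mul1r lerD2r.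
have -> : w - (v + t%:C * (w - v)) = (1 - t)%:C * (w - v).
  by rewrite rmorphB /=; ring.
rewrite mulrA -rmorphM /= mulfVK ?gt_eqF // rmorphB /=; ring.
Qed.

(** Visit the points in the order in which the path first meets them.  Each time the
point of the first segment closest to its origin is split off; when the
first segment holds no more points, the triangle inequality skips its end. *)
Lemma polyline_shortcut v s S : uniq S -> (forall z, z \in S -> polyline v s z) ->
  exists2 l, perm_eq l S & polyline_length v l <= polyline_length v s.
Proof.
elim: s v S => [|w s IH] v S uS HS.
  exists S => //=; case: S uS HS => [|z [|z' S]] //= uS HS.
    by have -> : z = v := HS z (mem_head _ _); rewrite subrr normc0 addr0.
  have E : z = v := HS z (mem_head _ _).
  have E' : z' = v by apply: HS; rewrite !inE eqxx orbT.
  by move: uS; rewrite E E' inE eqxx.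
have [n] := ubnP (size S); elim: n v S uS HS => // n IHn v S uS HS nS.
have [[x xS Hx]|no] := pselect (exists2 x, x \in S & segment v w x); last first.
  have [|l lS Hl] := IH w S uS.
    by move=> z zS; have [zv|//] := HS z zS; exfalso; apply: no; exists z.
  exists l => //=; apply: le_trans (polyline_length_detour _ w _) _.
  by rewrite lerD2l.
pose S1 := [seq z <- S | `[< segment v w z >]].
have xS1 : x \in S1 by rewrite mem_filter xS andbT; exact/asboolP.
have [p] := exists_min_seq (fun z => normc (z - v)) xS1.
rewrite mem_filter => /andP[/asboolP vp pS] Hp.
have sr : (size (rem p S) < n)%N by move: nS; rewrite size_rem //; case: (S) pS.
have rS z : z \in rem p S -> polyline p (w :: s) z.
  rewrite mem_rem_uniq // inE => /andP[zp zS].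
  have [vz|wz] := HS z zS; last by right.
  have zS1 : z \in S1 by rewrite mem_filter zS andbT; exact/asboolP.
  by left; exact: (segment_suffix vp vz (Hp z zS1)).
have [l lS Hl] := IHn p (rem p S) (rem_uniq p uS) rS sr.
exists (p :: l); first by rewrite (perm_trans _ (_ : perm_eq (p :: rem p S) S)) ?perm_cons // perm_sym perm_to_rem.
rewrite /= in Hl *; apply: le_trans (_ : normc (p - v) + (normc (w - p) + polyline_length w s) <= _).
  by rewrite lerD2l.
rewrite addrA lerD2r; have [t /= /andP[t0 t1] <-] := vp.
have -> : w - (v + t%:C * (w - v)) = (1 - t)%:C * (w - v).
  by rewrite rmorphB /=; ring.
rewrite addrAC subrr add0r !normcM !normcR !ger0_norm ?subr_ge0 //; lra.
Qed.

Lemma polyline_mem v s z : z \in v :: s -> polyline v s z.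
Proof.
elim: s v => [|w s IH] v; first by rewrite inE => /eqP.
rewrite inE => /orP[/eqP ->|/IH]; last by right.
by left; exists 0; rewrite /= ?lexx ?ler01 // mul0r addr0.
Qed.

End Path.

(** * Amplitudes of which none dominates *)

Section Dominance.
Variable R : realType.

(** The bound is strict because the geometric series with ratio 1/3 is truncated; it
is what makes powers of 3 sufficient in [not_dominant]. *)
Lemma geometric_tail (M : R) (B : nat -> R) n : 0 < M ->
  (forall d : nat, (d < n)%N -> B d * 3 ^+ d.+1 <= M) ->
  \sum_(0 <= d < n) B d < M / 2.
Proof.
move=> M0 H; suff : \sum_(0 <= d < n) B d <= M / 2 * (1 - (3 ^+ n)^-1).
  move=> h; apply: le_lt_trans h _; by rewrite gtr_pMr ?divr_gt0 // gtrBl invr_gt0 exprn_gt0.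
elim: n H => [|n IH] H; first by rewrite big_nil expr0 invr1 subrr mulr0.
rewrite big_nat_recr //=; have {}IH := IH (fun d dn => H d (ltnW dn)).
have := H n (ltnSn n); have p0 : 0 < 3 ^+ n :> R by rewrite exprn_gt0.
rewrite exprS mulrCA => Hn.
have : B n <= M / 3 * (3 ^+ n)^-1 by rewrite ler_pdivlMr //; lra.
rewrite invfM; lra.
Qed.

Lemma not_dominant (A : nat -> R) n j : (j < n)%N -> 0 < A j ->
  (forall i : nat, (i < j)%N -> A i * 3 ^+ (j - i) <= A j) ->
  (forall i : nat, (j < i < n)%N -> A i * 3 ^+ (i - j) <= A j) ->
  \sum_(0 <= i < j) A i + \sum_(j.+1 <= i < n) A i < A j.
Proof.
move=> jn Aj H1 H2.
have h1 : \sum_(0 <= i < j) A i < A j / 2.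
  rewrite big_nat_rev /= add0n; apply: geometric_tail => // d dj.
  have := H1 (j - d.+1)%N; rewrite subKn // => H; apply: H.
  by move: dj; clear; lia.
have h2 : \sum_(j.+1 <= i < n) A i < A j / 2.
  rewrite -{1}[j.+1]add0n big_addn; apply: geometric_tail => // d dj.
  have := H2 (d + j.+1)%N; rewrite addnS -addSn addnK => H; apply: H.
  by rewrite addSn ltnS leq_addl /=; lia.
lra.
Qed.

(** The index [m] separates [0 .. m] from [m + 1 .. n - 1], and each of the two
groups has a member that, up to powers of 3, is not dominated by any member
of the other group. *)
Definition crossing (A : nat -> R) (n m : nat) : Prop :=
  (exists q : nat, [/\ (m < q < n)%N, 0 < A q &
     forall p : nat, (p <= m)%N -> A p <= 3 ^+ (q - p) * A q]) /\
  (exists p : nat, [/\ (p <= m)%N, 0 < A p &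
     forall q : nat, (m < q < n)%N -> A q <= 3 ^+ (q - p) * A p]).

(** Take the largest amplitude [j].  Some other amplitude [i] is at least
[3^-|i - j|] times as large, otherwise the term [j] would exceed the sum of all
others.  Separate between [j] and its neighbour on the side of [i]. *)
Lemma crossing_exists (G : nat -> R[i]) (n : nat) : \sum_(0 <= i < n) G i = 0 ->
  (exists2 i : nat, (i < n)%N & G i != 0) ->
  exists2 m, (m.+1 < n)%N & crossing (fun i => normc (G i)) n m.
Proof.
move=> G0 [i0 i0n Gi0]; pose A i := normc (G i).
have [j jn Hj] : exists2 j, (j < n)%N & forall i : nat, (i < n)%N -> A i <= A j.
  have := @exists_min_seq R _ (fun i => - A i) i0 (iota 0 n).
  rewrite mem_iota /= add0n => /(_ i0n)[j]; rewrite mem_iota /= add0n => jn Hj.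
  by exists j => // i i_n; rewrite -lerN2; apply: Hj; rewrite mem_iota /= add0n.
have Aj : 0 < A j by apply: lt_le_trans (Hj _ i0n); rewrite normc_gt0.
have le_sum : A j <= \sum_(0 <= i < j) A i + \sum_(j.+1 <= i < n) A i.
  have nsum (a b : nat) : normc (\sum_(a <= i < b) G i) <= \sum_(a <= i < b) A i.
    apply: (big_ind2 (fun x y => normc x <= y)) => //.
      by rewrite normc0.
    by move=> x1 x2 y1 y2 h1 h2; apply: le_trans (le_normcD _ _) (lerD h1 h2).
  have E : G j = - (\sum_(0 <= i < j) G i + \sum_(j.+1 <= i < n) G i).
    apply/eqP; rewrite -addr_eq0; apply/eqP; rewrite -[RHS]G0.
    rewrite [RHS](@big_cat_nat _ _ _ j) ?(ltnW jn) //=.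
    rewrite [X in _ = _ + X](big_ltn jn) /=; ring.
  rewrite {1}/A E normcN; apply: le_trans (le_normcD _ _) _.
  exact: lerD (nsum _ _) (nsum _ _).
have ge1 d : 1 <= 3 ^+ d :> R by rewrite exprn_ege1 //; lra.
have ge3 d e : (d <= e)%N -> 3 ^+ d <= 3 ^+ e :> R by move=> de; rewrite ler_weXn2l //; lra.
have A0 i : 0 <= A i := normc_ge0 _.
have up d i e : A i <= A e -> A i <= 3 ^+ d * A e.
  by move=> h; apply: le_trans h _; rewrite ler_peMl.
have [[i ij Hi]|no1] := pselect (exists2 i, (i < j)%N & A j <= 3 ^+ (j - i) * A i).
  have Ai : 0 < A i.
    have := lt_le_trans Aj Hi; rewrite pmulr_rgt0 //; exact: lt_le_trans ltr01 (ge1 _).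
  exists j.-1; first by rewrite prednK // (leq_ltn_trans _ ij).
  have j0 : (0 < j)%N by exact: leq_ltn_trans ij.
  split.
    exists j; split=> //; first by rewrite prednK // leqnn.
    by move=> p pj; apply: up; apply: Hj; lia.
  exists i; split=> //; first by lia.
  move=> q /andP[jq qn]; apply: le_trans (Hj q qn) _; apply: le_trans Hi _.
  by rewrite ler_wpM2r // ge3 //; lia.
have [[i /andP[ji i_n] Hi]|no2] := pselect (exists2 i, (j < i < n)%N & A j <= 3 ^+ (i - j) * A i).
  have Ai : 0 < A i.
    have := lt_le_trans Aj Hi; rewrite pmulr_rgt0 //; exact: lt_le_trans ltr01 (ge1 _).
  exists j; first exact: leq_ltn_trans i_n.
  split.
    exists i; split=> //; first by rewrite ji.
    move=> p pj; apply: le_trans (Hj p (leq_ltn_trans pj jn)) _; apply: le_trans Hi _.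
    by rewrite ler_wpM2r // ge3 //; lia.
  by exists j; split=> // q /andP[jq qn]; apply: up; exact: Hj.
exfalso; move: le_sum; rewrite leNgt => /negP; apply; apply: not_dominant => // i Hi.
  rewrite leNgt; apply/negP => h; apply: no1; exists i => //.
  by rewrite mulrC ltW.
rewrite leNgt; apply/negP => h; apply: no2; exists i => //.
by rewrite mulrC ltW.
Qed.

(** Compare the distinguished late amplitude at the first point with the
distinguished early one at the second: their ratio has grown by at most
[9^(j - i)] and by at least [exp ((j - i) X)]. *)
Lemma crossing_spread (A A' : nat -> R) (n m : nat) (X : R) :
  (forall i, 0 <= A i) -> (forall i, 0 <= A' i) ->
  crossing A n m -> crossing A' n m ->
  (forall i j : nat, (i < j < n)%N ->
     A j * A' i * expR ((j - i)%:R * X) <= A' j * A i) ->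
  X <= 2 * ln 3.
Proof.
move=> A0 A'0 [[q [/andP[mq qn] Aq Hq]] _] [_ [p [pm Ap Hp]]] H.
have pq : (p < q)%N by exact: leq_ltn_trans mq.
have {}H := H p q; rewrite pq qn in H; have {}H := H isT.
have {}Hq := Hq p pm; have {}Hp := Hp q; rewrite mq qn in Hp; have {}Hp := Hp isT.
set d := (q - p)%N in H Hq Hp.
have d0 : (0 < d)%N by rewrite subn_gt0.
have t0 : 0 < 3 ^+ d :> R by rewrite exprn_gt0.
have : A q * A' p * expR (d%:R * X) <= A q * A' p * (3 ^+ d * 3 ^+ d).
  apply: le_trans H _.
  by apply: le_trans (ler_pM _ _ Hp Hq) _ => //; rewrite mulrACA mulrC [A' p * _]mulrC.
rewrite ler_pM2l ?mulr_gt0 //.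
have -> : (3 ^+ d : R) = expR (d%:R * ln 3) by rewrite expRM_natl lnK // posrE.
rewrite -expRD ler_expR -mulrDr ler_pM2l ?ltr0n //; lra.
Qed.
End Dominance.

(** * Growth of the terms of an exponential sum *)

Section Spread.
Variable R : realType.
Implicit Types (z w : R[i]) (lam : nat -> R[i]) (P : nat -> {poly R[i]}).

(** [log (1 + x) <= x]. *)
Lemma factor_growth (D : R) z w c : 0 < D -> D <= `|Re z - Re c| ->
  normc (w - c) <= normc (z - c) * expR (normc (w - z) / D).
Proof.
move=> D0 Dz; have zc : D <= normc (z - c).
  by apply: le_trans Dz _; apply: le_trans (ler_Re_normc _); rewrite ReD ReN.
apply: le_trans (ler_normcBD _ _ z) _.
have := expR_ge1Dx (normc (w - z) / D); move: (expR _) => X hX.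
have n0 := normc_ge0 (w - z).
apply: le_trans (_ : normc (z - c) * (1 + normc (w - z) / D) <= _); last first.
  by rewrite ler_wpM2l ?normc_ge0.
rewrite mulrDr mulr1 addrC lerD2l mulrCA ler_peMr // ler_pdivlMr // mul1r //.
Qed.

Lemma poly_growth (D : R) (p : {poly R[i]}) (K : nat) z w : 0 < D ->
  (size p <= K.+1)%N ->
  (forall c, p != 0 -> root p c -> D <= `|Re z - Re c|) ->
  normc p.[w] <= normc p.[z] * expR (K%:R / D * normc (w - z)).
Proof.
move=> D0 sp H; have [->|p0] := eqVneq p 0.
  by rewrite !horner0 normc0 mul0r.
have [r pE] := closed_field_poly_normal p.
have hr c : c \in r -> D <= `|Re z - Re c|.
  by move=> cr; apply: H => //; rewrite pE rootZ ?lead_coef_eq0 // root_prod_XsubC.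
have sr : (size r <= K)%N.
  by move: sp; rewrite {1}pE size_scale ?lead_coef_eq0 // size_prod_XsubC ltnS.
have e0 := divr_ge0 (normc_ge0 (w - z)) (ltW D0).
apply: le_trans (_ : normc p.[z] * expR ((size r)%:R * (normc (w - z) / D)) <= _); last first.
  rewrite ler_wpM2l ?normc_ge0 // ler_expR mulrAC -mulrA.
  by rewrite ler_wpM2r // ler_nat.
rewrite pE !hornerZ !normcM -mulrA ler_wpM2l ?normc_ge0 //.
elim: (r) hr => [|c s IH] hr.
  by rewrite !big_nil !hornerC mul0r expR0 mulr1.
rewrite !big_cons !hornerM !hornerXsubC !normcM /= -natr1 mulrDl mul1r expRD.
rewrite [_ * expR (normc _ / D)]mulrC mulrACA.
apply: ler_pM; rewrite ?normc_ge0 //.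
  by apply: factor_growth => //; apply: hr; rewrite mem_head.
by apply: IH => d ds; apply: hr; rewrite inE ds orbT.
Qed.

Definition term lam P (i : nat) z : R[i] := (P i).[z] * cexp (lam i) z.

Lemma normc_term lam P i z : normc (term lam P i z) = normc (P i).[z] * expR (Re (lam i * z)).
Proof. by rewrite /term normcM normc_cexp. Qed.

(** The moduli of two terms with indices [i < j] have a ratio which, when [z] moves to
[w], grows at a rate of at least [delta (j - i)] horizontally; the slope [xi]
turns vertical displacements into horizontal ones, and [L] is the rate at which
the polynomial factors can counteract. *)
Lemma crossing_strip (alpha delta xi L : R) lam P (n m : nat) z w :
  0 <= alpha -> 0 <= xi -> 0 <= L ->
  (forall i j : nat, (i < j < n)%N ->
     delta * (j - i)%:R <= Re (lam j) - Re (lam i) /\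
     `|Im (lam j) - Im (lam i)| <= xi * (Re (lam j) - Re (lam i))) ->
  `|Im z| <= alpha -> `|Im w| <= alpha ->
  (forall i : nat, (i < n)%N ->
     normc (P i).[z] <= normc (P i).[w] * expR (L * normc (w - z)) /\
     normc (P i).[w] <= normc (P i).[z] * expR (L * normc (w - z))) ->
  crossing (fun i => normc (term lam P i z)) n m ->
  crossing (fun i => normc (term lam P i w)) n m ->
  2 * alpha * xi <= Re w - Re z ->
  delta * (Re w - Re z - 2 * alpha * xi) - 2 * L * (Re w - Re z + 2 * alpha) <= 2 * ln 3.
Proof.
move=> a0 xi0 L0 Hlam zs ws HP cz cw xzw.
apply: (@crossing_spread _ _ _ n m _ _ _ cz cw) => [i|i|i j /andP[ij jn]]; rewrite ?normc_ge0 //.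
have i_n := ltn_trans ij jn.
have [Hd Hi] := Hlam i j (introT andP (conj ij jn)).
have [Hj _] := HP j jn; have [_ {}HP] := HP i i_n.
have X0 : (1 : R) <= (j - i)%:R by rewrite (ler_nat _ 1) subn_gt0.
have dzw : normc (w - z) <= Re w - Re z + 2 * alpha.
  apply: le_trans (normc_le _) _; rewrite !ReImE [`|Re w - _|]ger0_norm; last by apply: le_trans xzw; rewrite !mulr_ge0.
  rewrite lerD2l; apply: le_trans (ler_normB _ _) _; lra.
rewrite !normc_term.
set N := normc (w - z) in Hj HP dzw.
set E := expR (L * N) in Hj HP.
have E0 : 0 < E := expR_gt0 _.
set Y := (j - i)%:R * _.
have key : Re (lam j * z) + Re (lam i * w) + Y + L * N + L * N <= Re (lam j * w) + Re (lam i * z).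
  have ia : `|(Im (lam j) - Im (lam i)) * (Im w - Im z)| <= xi * (Re (lam j) - Re (lam i)) * (2 * alpha).
    rewrite normrM ler_pM // (le_trans (ler_normB _ _)) //; lra.
  have {}ia := le_trans (ler_norm _) ia.
  have LN : 2 * (L * N) <= (j - i)%:R * (2 * L * (Re w - Re z + 2 * alpha)).
    have h : 0 <= 2 * (L * N) by rewrite !mulr_ge0 // normc_ge0.
    apply: le_trans (_ : (j - i)%:R * (2 * (L * N)) <= _); first by rewrite ler_peMl.
    by rewrite ler_wpM2l // -mulrA ler_wpM2l // ler_wpM2l.
  have dd : (j - i)%:R * (delta * (Re w - Re z - 2 * alpha * xi)) <= (Re (lam j) - Re (lam i)) * (Re w - Re z - 2 * alpha * xi).
    rewrite mulrA [_ * delta]mulrC ler_wpM2r ?subr_ge0 //.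
  rewrite /Y !ReM; lra.
have := ler_pM _ _ Hj HP; rewrite !normc_ge0 => /(_ isT isT) HH.
have HE : expR (Re (lam j * z)) * expR (Re (lam i * w)) * expR Y * E * E <=
    expR (Re (lam j * w)) * expR (Re (lam i * z)) by rewrite -!expRD ler_expR.
set e1 := expR (Re (lam j * z)) in HE *; set e2 := expR (Re (lam i * w)) in HE *.
set e3 := expR Y in HE *; set e4 := expR (Re (lam j * w)) in HE *.
set e5 := expR (Re (lam i * z)) in HE *.
have AB : 0 <= normc (P j).[w] * normc (P i).[z] by rewrite mulr_ge0 ?normc_ge0.
have e123 : 0 <= e1 * e2 * e3 by rewrite !mulr_ge0 // expR_ge0.
have h1 := ler_wpM2r e123 HH; have h2 := ler_wpM2l AB HE; lra.
Qed.

End Spread.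

(** * Counting the zeros in a strip *)

Section Core.
Variable R : realType.
Implicit Types (y : R[i] -> R[i]) (z w : R[i]).

Lemma zero_count_le y (A : set R[i]) (m : R[i] -> nat) (B : R) :
  (forall z, (multiplicity y z <= ((m z)%:R : R)%:E)%E) ->
  (forall F : seq R[i], uniq F -> (forall z, z \in F -> A z) ->
     (\sum_(z <- F) m z)%:R <= B) ->
  (zero_count y A <= B%:E)%E.
Proof.
move=> Hm HB; apply: ge_ereal_sup => _ [X [fX XA] <-].
rewrite fsbig_finite //=; set F := finmap.enum_fset _.
apply: (@le_trans _ _ (\sum_(z <- F) ((m z)%:R : R)%:E)%E).
  by apply: lee_sum => z _; exact: Hm.
rewrite sumEFin lee_fin -natr_sum; apply: HB; first exact: finmap.fset_uniq.
by move=> z; rewrite in_fset_set // inE => /XA.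
Qed.

Lemma multiplicity_le y z (m : nat) : cderiv m y z <> 0 ->
  (multiplicity y z <= (m%:R : R)%:E)%E.
Proof. by move=> H; apply: ereal_inf_lbound; exists m. Qed.

Lemma zero_count_ge0 y (A : set R[i]) : (0 <= zero_count y A)%E.
Proof.
apply: esum_ge0 => z _; apply: le_ereal_inf_tmp => _ [n _ <-].
by rewrite lee_fin.
Qed.

(** The zeros in one class fit in a rectangle of width [S] and height [2 alpha], to
which [zeros_in_rect] applies. *)
Lemma zero_count_classes (alpha S : R) y (a : R[i]) (t : seq R[i]) (M : nat)
    (C : nat -> R[i] -> Prop) :
  0 <= alpha -> 0 <= S -> annihilated (a :: t) y -> nontrivial y ->
  (forall z, `|Im z| <= alpha -> y z = 0 -> exists2 l, (l < M)%N & C l z) ->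
  (forall l z w, (l < M)%N -> `|Im z| <= alpha -> `|Im w| <= alpha ->
     C l z -> C l w -> Re w - Re z <= S) ->
  (zero_count y (strip alpha) <=
   (M%:R * ((size t)%:R + polyline_length a t * (S + 2 * alpha) / pi))%:E)%E.
Proof.
move=> a0 S0 anny ny Hex Hsp.
have /choice[m mP] : forall z, exists m : nat, zero_order y z m /\ cderiv m y z <> 0.
  by move=> z; have [m [_ h1 h2 _]] := annihilated_zero_order z anny ny; exists m.
have [c cP] : exists c : R[i] -> nat, forall z, `|Im z| <= alpha -> y z = 0 -> (c z < M)%N /\ C (c z) z.
  have /choice[c cP] : forall z, exists l, `|Im z| <= alpha -> y z = 0 -> (l < M)%N /\ C l z.
    move=> z; have [[h1 h2]|no] := pselect (`|Im z| <= alpha /\ y z = 0).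
      by have [l lM Cl] := Hex z h1 h2; exists l.
    by exists 0%N => h1 h2; exfalso; apply: no.
  by exists c.
apply: (@zero_count_le _ _ m) => [z|F uF FA].
  by apply: multiplicity_le; have [] := mP z.
set b := _ + _.
have pi0 := pi_gt0 R.
have b0 : 0 <= b.
  by rewrite /b addr_ge0 // divr_ge0 ?(ltW pi0) // mulr_ge0 ?polyline_length_ge0 // addr_ge0 // mulr_ge0.
have class l : (l < M)%N -> (\sum_(z <- F | (y z == 0) && (c z == l)) m z)%:R <= b.
  move=> lM; rewrite -big_filter; set G := [seq z <- F | _].
  have GP z : z \in G -> [/\ `|Im z| <= alpha, y z = 0, C l z & z \in F].
    rewrite mem_filter => /andP[/andP[/eqP yz /eqP cl] zF]; split=> //; first exact: FA.
    by have [] := cP z (FA z zF) yz; rewrite cl.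
  have [G0|[x xG]] : G = [::] \/ exists x, x \in G.
    by case: (G) => [|x G']; [left | right; exists x; rewrite mem_head].
    by rewrite G0 big_nil.
  have [p pG Hp] := exists_min_seq (fun z => Re z) xG.
  have [pa py pC _] := GP p pG.
  have := @zeros_in_rect R (Re p) (Re p + S) (- alpha) alpha t a y m G.
  have xx : Re p <= Re p + S by rewrite lerDl.
  have aa : - alpha <= alpha by lra.
  move=> /(_ xx aa anny ny (fun z => (mP z).1) (filter_uniq _ uF)) H.
  have rG : forall z, z \in G -> rect (Re p) (Re p + S) (- alpha) alpha z.
    move=> z zG; have [za yz zC _] := GP z zG; split; last by rewrite -ler_norml.
    by rewrite Hp //= addrC -lerBlDr; apply: Hsp lM pa za pC zC.
  have := H rG; rewrite /perimeter => h.
  rewrite -(@ler_pM2l _ (2 * pi)) ?mulr_gt0 //; apply: le_trans h _.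
  rewrite le_eqVlt; apply/orP; left; apply/eqP.
  have pn : pi != 0 :> R by rewrite gt_eqF.
  by rewrite /b; move: (@pi R) pn => q qn; field.
case: M Hex Hsp cP class => [|M] Hex Hsp cP class.
  rewrite mul0r big1_seq // => z /andP[_ zF]; apply/eqP; rewrite -leqn0 leqNgt -(zero_order_eq0 (mP z).1).
  by apply/negP => /eqP yz; have [] := cP z (FA z zF) yz.
rewrite (bigID (fun z => y z == 0)) /= [X in (_ + X)%N]big1 ?addn0; last first.
  by move=> z; rewrite (zero_order_eq0 (mP z).1) lt0n negbK => /eqP.
rewrite (@partition_big _ _ _ _ _ 'I_M.+1 _ (fun z => inord (c z)) predT) //=.
have -> : M.+1%:R * b = \sum_(l < M.+1) b by rewrite sumr_const card_ord mulr_natl.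
rewrite natr_sum.
apply: ler_sum => l _; apply: le_trans (class l (ltn_ord l)).
rewrite ler_nat big_seq_cond [leqRHS]big_seq_cond; apply/eq_leq/eq_bigl => z.
have [zF|//] := boolP (z \in F); have [yz|//] := eqVneq (y z) 0.
have [cM _] := cP z (FA z zF) yz.
by rewrite -val_eqE /= inordK.
Qed.

Lemma all_roots (n K : nat) (P : nat -> {poly R[i]}) :
  (forall i : nat, (i < n)%N -> (size (P i) <= K.+1)%N) ->
  exists2 rs : seq R[i], (size rs <= n * K)%N &
    forall (i : nat) c, (i < n)%N -> P i != 0 -> root (P i) c -> c \in rs.
Proof.
elim: n => [|n IH] HP; first by exists [::].
have [|rs srs Hrs] := IH; first by move=> i i_n; apply: HP; exact: ltnW.
have [r [sr Hr]] : exists r : seq R[i], (size r <= K)%N /\ forall c, P n != 0 -> root (P n) c -> c \in r.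
  have [->|p0] := eqVneq (P n) 0; first by exists [::].
  have [r pE] := closed_field_poly_normal (P n); exists r; split.
    have := HP n (ltnSn n); rewrite pE size_scale ?lead_coef_eq0 //.
    by rewrite size_prod_XsubC ltnS.
  by move=> c _; rewrite pE rootZ ?lead_coef_eq0 // root_prod_XsubC.
exists (r ++ rs); first by rewrite size_cat mulSn leq_add.
move=> i c; rewrite ltnS leq_eqVlt mem_cat => /orP[/eqP ->|i_n] p0 pc.
  by rewrite Hr.
by rewrite (Hrs i) ?orbT.
Qed.

(** One class for each zero [c] of the polynomial factors, consisting of the zeros of
[y] with real part within [D] of that of [c]; the others are sorted by crossing
index. *)
Lemma zero_count_expsum (alpha delta xi D S : R) (lam : nat -> R[i])
    (P : nat -> {poly R[i]}) (n K : nat) (rs : seq R[i]) y (a : R[i]) (t : seq R[i]) :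
  0 <= alpha -> 0 <= xi -> 0 < D -> 0 <= S ->
  annihilated (a :: t) y -> nontrivial y ->
  (forall z, y z = \sum_(0 <= i < n) term lam P i z) ->
  (forall i j : nat, (i < j < n)%N ->
     delta * (j - i)%:R <= Re (lam j) - Re (lam i) /\
     `|Im (lam j) - Im (lam i)| <= xi * (Re (lam j) - Re (lam i))) ->
  (forall i : nat, (i < n)%N -> (size (P i) <= K.+1)%N) ->
  (forall (i : nat) c, (i < n)%N -> P i != 0 -> root (P i) c -> c \in rs) ->
  (rs != [::] -> 2 * D <= S) ->
  ((1 < n)%N -> 2 * alpha * xi <= S) ->
  ((1 < n)%N -> forall x, 2 * alpha * xi <= x ->
     delta * (x - 2 * alpha * xi) - 2 * (K%:R / D) * (x + 2 * alpha) <= 2 * ln 3 -> x <= S) ->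
  (zero_count y (strip alpha) <=
   ((size rs + n.-1)%:R * ((size t)%:R + polyline_length a t * (S + 2 * alpha) / pi))%:E)%E.
Proof.
move=> a0 xi0 D0 S0 anny ny yE Hlam HP Hrs rsS n1S n1X.
pose far z := forall c, c \in rs -> D <= `|Re z - Re c|.
pose C l z := if (l < size rs)%N then (`|Re z - Re (nth 0 rs l)| < D : Prop)
  else far z /\ crossing (fun i => normc (term lam P i z)) n (l - size rs).
have L0 : 0 <= K%:R / D by rewrite divr_ge0 // ltW.
apply: (@zero_count_classes alpha S y a t _ C) => //.
  move=> z za yz; have [fz|nf] := pselect (far z); last first.
    have [c crs Hc] : exists2 c, c \in rs & `|Re z - Re c| < D.
      apply: contrapT => no; apply: nf => c crs; rewrite leNgt; apply/negP => h.
      by apply: no; exists c.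
    have irs : (index c rs < size rs)%N by rewrite index_mem.
    exists (index c rs); first by rewrite ltn_addr.
    by rewrite /C irs nth_index.
  have [i i_n ti] : exists2 i : nat, (i < n)%N & term lam P i z != 0.
    have [w yw] := ny; apply: contrapT => no; apply: yw.
    rewrite yE big_nat big1 // => i /andP[_ i_n]; rewrite /term.
    suff -> : P i = 0 by rewrite horner0 mul0r.
    apply: contrapT => /eqP p0; apply: no; exists i => //.
    rewrite mulf_neq0 ?cexp_neq0 //; apply/negP => pz.
    have := fz z (Hrs i z i_n p0 pz); rewrite subrr normr0 leNgt D0 //.
  have [|m mn cr] := @crossing_exists R (fun i => term lam P i z) n _ (ex_intro2 _ _ i i_n ti).
    by rewrite -yE.
  exists (size rs + m)%N; first by rewrite ltn_add2l; lia.
  by rewrite /C ltnNge leq_addr /= addKn.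
move=> l z w lM za wa; rewrite /C; case: ifP => lrs.
  move=> h1 h2; have : rs != [::] by case: (rs) lrs.
  move=> /rsS; apply: le_trans; rewrite ltr_norml in h1; rewrite ltr_norml in h2.
  by move: h1 h2 => /andP[? ?] /andP[? ?]; lra.
move=> [fz cz] [fw cw]; have n1 : (1 < n)%N by lia.
have [xzw|/ltW xzw] := leP (2 * alpha * xi) (Re w - Re z); last first.
  exact: le_trans xzw (n1S n1).
apply: n1X => //.
apply: (@crossing_strip R alpha delta xi (K%:R / D) lam P n (l - size rs) z w) => //.
move=> i i_n; split.
  by rewrite normcB; apply: poly_growth => //; [exact: HP | move=> c p0 pc; apply: fw; exact: Hrs i_n p0 pc].
by apply: poly_growth => //; [exact: HP | move=> c p0 pc; apply: fz; exact: Hrs i_n p0 pc].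
Qed.

End Core.

(** * Gaps between consecutive roots *)

Section Gaps.
Variable R : realType.
Implicit Types (lambda : nat -> R[i]).

Lemma le_bigmax_nat (F : nat -> R) (n j : nat) : (1 <= j < n)%N ->
  F j <= \big[Num.max/0]_(1 <= i < n) F i.
Proof. by move=> jn; apply: le_bigmax_seq; rewrite ?mem_index_iota. Qed.

Lemma bigmax_nat_ge0 (F : nat -> R) (n : nat) : 0 <= \big[Num.max/0]_(1 <= i < n) F i.
Proof. exact: bigmax_ge_id. Qed.

(** Both inequalities hold for neighbours by definition and add up. *)
Lemma Re_gap lambda (n i j : nat) :
  (forall j : nat, (1 <= j < n)%N -> Re (lambda j) < Re (lambda j.+1)) ->
  (i < j < n)%N ->
  (j - i)%:R <= Theta n lambda * (Re (lambda j.+1) - Re (lambda i.+1)) /\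
  `|Im (lambda j.+1) - Im (lambda i.+1)| <= Xi n lambda * (Re (lambda j.+1) - Re (lambda i.+1)).
Proof.
move=> H; elim: j => // j IH /andP[ij jn].
have step : 1 <= Theta n lambda * (Re (lambda j.+2) - Re (lambda j.+1)) /\
    `|Im (lambda j.+2) - Im (lambda j.+1)| <= Xi n lambda * (Re (lambda j.+2) - Re (lambda j.+1)).
  have jn' : (1 <= j.+1 < n)%N by rewrite jn.
  have g := H _ jn'; have g0 : 0 < Re (lambda j.+2) - Re (lambda j.+1) by rewrite subr_gt0.
  have E : `|Re (lambda j.+1) - Re (lambda j.+2)| = Re (lambda j.+2) - Re (lambda j.+1).
    by rewrite distrC gtr0_norm.
  split; rewrite -ler_pdivrMr //.
    by rewrite mul1r -E; exact: (le_bigmax_nat (fun j => `|Re (lambda j) - Re (lambda j.+1)|^-1)).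
  rewrite -E distrC -normfV -normrM.
  exact: (le_bigmax_nat (fun j => `|(Im (lambda j) - Im (lambda j.+1)) / (Re (lambda j) - Re (lambda j.+1))|)).
have [s1 s2] := step.
move: ij; rewrite ltnS leq_eqVlt => /orP[/eqP ->|ij]; first by rewrite subSnn.
have [h1 h2] := IH (introT andP (conj ij (ltnW jn))).
split; first by rewrite subSn ?(ltnW ij) // -natr1; lra.
have -> : Im (lambda j.+2) - Im (lambda i.+1) = (Im (lambda j.+2) - Im (lambda j.+1)) + (Im (lambda j.+1) - Im (lambda i.+1)) by ring.
by apply: le_trans (ler_normD _ _) _; lra.
Qed.

End Gaps.

(** * The characteristic polynomial *)

Section Equation.
Variable R : realType.
Implicit Types (k : nat) (a : nat -> R[i]) (y : R[i] -> R[i]).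

Lemma charpoly_size k a : a k != 0 -> size (charpoly k a) = k.+1.
Proof. by move=> ak; rewrite size_poly_eq. Qed.

Lemma charpoly_factor k a : a k != 0 ->
  exists2 s : seq R[i], size s = k & charpoly k a = a k *: \prod_(z <- s) ('X - z%:P).
Proof.
move=> ak; have [s sE] := closed_field_poly_normal (charpoly k a).
have lc : lead_coef (charpoly k a) = a k by rewrite lead_coef_poly.
rewrite lc in sE; exists s => //.
have := charpoly_size ak; rewrite sE size_scale // size_prod_XsubC; by case.
Qed.

Lemma char_roots_mem k a (s : seq R[i]) z : a k != 0 ->
  charpoly k a = a k *: \prod_(z <- s) ('X - z%:P) ->
  char_roots k a z <-> z \in s.
Proof. by move=> ak sE; rewrite /char_roots /= sE rootZ // root_prod_XsubC. Qed.

Lemma solution_annihilated k a (s : seq R[i]) y : a k != 0 -> size s = k ->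
  charpoly k a = a k *: \prod_(z <- s) ('X - z%:P) -> is_solution k a y -> annihilated s y.
Proof.
move=> ak sk sE [sm eq]; apply: (annihilated_factor ak); first by rewrite sk.
move=> z; rewrite sk -[RHS](eq z); apply: eq_bigr => j _.
by rewrite -sE coef_poly ltn_ord.
Qed.

Lemma solution_terms (r s : seq R[i]) y : uniq r -> {subset s <= r} -> annihilated s y ->
  exists P : nat -> {poly R[i]},
    (forall i : nat, (i < size r)%N -> (size (P i) <= count_mem (nth 0%R r i) s)%N) /\
    (forall z, y z = \sum_(0 <= i < size r) term (nth 0 r) P i z).
Proof.
move=> ur sr anny; have [p ps pE] := annihilated_expsum ur sr anny.
exists (fun i => p (nth 0 r i)); split; first by move=> i _; exact: ps.
by move=> z; rewrite pE /expsum (big_nth 0).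
Qed.

End Equation.

(** * The two bounds *)

Section Main.
Variable R : realType.

(** The polynomial factors have at most [n k] zeros altogether, whatever the solution,
so the number of classes and the width of each are bounded in terms of the
equation and the strip. *)
Lemma finite_bound (alpha : R) (k : nat) (a : nat -> R[i]) :
  0 <= alpha -> (0 < k)%N -> a k != 0 ->
  (forall u v : R[i], char_roots k a u -> char_roots k a v ->
     u <> v -> Re u <> Re v) ->
  exists N : nat, forall y : R[i] -> R[i],
    is_solution k a y -> nontrivial y ->
    (zero_count y (strip alpha) <= (N%:R)%:E)%E.
Proof.
move=> a0 k0 ak dist; have [s sk sE] := charpoly_factor ak.
have [b [t st]] : exists b t, s = b :: t by case: (s) sk k0 => [<- //|b t]; exists b, t.
pose r := sort (fun u v : R[i] => Re u <= Re v) (undup s).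
pose n := size r.
have ur : uniq r by rewrite sort_uniq undup_uniq.
have mr z : (z \in r) = (z \in s) by rewrite mem_sort mem_undup.
pose lambda j := nth 0 r j.-1.
have sorted_r : sorted (fun u v : R[i] => Re u <= Re v) r.
  by apply: sort_sorted => u v; exact: le_total.
have lam_lt (j : nat) : (1 <= j < n)%N -> Re (lambda j) < Re (lambda j.+1).
  case: j => // j /andP[_ jn]; rewrite /lambda /=.
  have jn' := ltnW jn.
  rewrite lt_neqAle; apply/andP; split; last first.
    have := sorted_ltn_nth (leT := fun u v : R[i] => Re u <= Re v) _ 0 sorted_r.
    by move=> H; apply: H => //; first by move=> u v w; exact: le_trans.
  apply/eqP; apply: dist.
  - by apply/(char_roots_mem _ ak sE); rewrite -mr mem_nth.
  - by apply/(char_roots_mem _ ak sE); rewrite -mr mem_nth.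
  - by move/eqP; rewrite nth_uniq // => /eqP; lia.
pose T := Theta n lambda; pose X := Xi n lambda.
have T0 : 0 <= T := bigmax_nat_ge0 _ _.
have X0 : 0 <= X := bigmax_nat_ge0 _ _.
(* [T] is zero if there is only one root. *)
pose delta := (T + 1)^-1.
have d0 : 0 < delta by rewrite invr_gt0; lra.
(* At distance [D] from their zeros the polynomial factors grow at a rate of at most
   [k / D = delta / 4], so that two of them offset at most half of [delta]. *)
pose D := 4 * k%:R / delta.
have kR : 0 < k%:R :> R by rewrite ltr0n.
have D0 : 0 < D by rewrite divr_gt0 // mulr_gt0.
pose S := 2 * D + (4 * alpha * X + 2 * alpha + 4 * ln 3 / delta).
have ln3 : 0 <= ln 3 :> R by rewrite ln_ge0 //; lra.
have Y0 : 0 <= 4 * alpha * X + 2 * alpha + 4 * ln 3 / delta.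
  by rewrite !addr_ge0 // ?mulr_ge0 // ltW // invr_gt0.
have S0 : 0 <= S by rewrite addr_ge0 // mulr_ge0 // ltW.
pose B := (k%:R + polyline_length b t * (S + 2 * alpha) / pi).
have pi0 := pi_gt0 R.
have B0 : 0 <= B.
  by rewrite /B addr_ge0 // divr_ge0 ?(ltW pi0) // mulr_ge0 ?polyline_length_ge0 // addr_ge0 // mulr_ge0.
have nk : (n <= k)%N by rewrite /n size_sort -sk size_undup.
exists (Num.bound ((n * k + n.-1)%:R * B)) => y ysol ny.
have anny := solution_annihilated ak sk sE ysol.
have [P [HP yE]] := solution_terms ur (fun z zs => etrans (mr z) zs) anny.
have HP' (i : nat) : (i < n)%N -> (size (P i) <= k.+1)%N.
  by move=> i_n; apply: leq_trans (HP i i_n) _; rewrite (leq_trans (count_size _ _)) // sk.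
have [rs srs Hrs] := all_roots HP'.
have := @zero_count_expsum R alpha delta X D S (nth 0 r) P n k rs y b t a0 X0 D0 S0.
rewrite -st => /(_ anny ny yE).
have Hlam (i j : nat) : (i < j < n)%N ->
   delta * (j - i)%:R <= Re (nth 0 r j) - Re (nth 0 r i) /\
     `|Im (nth 0 r j) - Im (nth 0 r i)| <= X * (Re (nth 0 r j) - Re (nth 0 r i)).
  move=> ijn; have [h1 h2] := Re_gap lam_lt ijn; split=> //.
  rewrite /delta mulrC ler_pdivrMr; last by lra.
  rewrite /lambda /= -/T in h1.
  have : 0 <= Re (nth 0 r j) - Re (nth 0 r i).
    have j0 : 0 < (j - i)%:R :> R by rewrite ltr0n subn_gt0; case/andP: ijn.
    have := lt_le_trans j0 h1; have [T1|T1] := eqVneq T 0; first by rewrite T1 mul0r ltxx.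
    have Tp : 0 < T by rewrite lt_neqAle eq_sym T1.
    by rewrite pmulr_rgt0 // => h; exact: ltW h.
  lra.
move=> /(_ Hlam HP' Hrs); have dn : delta != 0 by rewrite gt_eqF.
have kn : k%:R != 0 :> R by rewrite gt_eqF.
move=> H; apply: le_trans (H _ _ _) _.
- by move=> _; rewrite lerDl.
- move=> _; rewrite /S; have : 0 <= 2 * alpha * X by rewrite !mulr_ge0.
  have : 0 <= 4 * ln 3 / delta by rewrite !mulr_ge0 // ltW // invr_gt0.
  lra.
- move=> _ x _; have -> : 2 * (k%:R / D) = delta / 2 by rewrite /D; field; rewrite dn kn.
  move=> hx; have : delta * x <= delta * (4 * alpha * X + 2 * alpha + 4 * ln 3 / delta).
    have -> : delta * (4 * alpha * X + 2 * alpha + 4 * ln 3 / delta) = delta * (4 * alpha * X + 2 * alpha) + 4 * ln 3 by field.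
    lra.
  by rewrite ler_pM2l // /S; lra.
rewrite lee_fin; apply: le_trans (_ : (n * k + n.-1)%:R * B <= _); last first.
  by apply: ltW; apply: archi_boundP; rewrite mulr_ge0.
apply: ler_pM => //.
- by rewrite addr_ge0 // divr_ge0 ?(ltW pi0) // mulr_ge0 ?polyline_length_ge0 // addr_ge0 // mulr_ge0.
- by rewrite ler_nat leq_add2r.
- by rewrite lerD2r ler_nat -sk st leqnSn.
Qed.

(** The factors of the exponentials are constants, so the only classes are the [k - 1]
crossing indices, with width [2 alpha Xi + 2 Theta ln 3].  The bound holds for
the length of every path through the roots, hence for the infimum. *)
Lemma explicit_bound (alpha : R) (k : nat) (a : nat -> R[i]) (lambda : nat -> R[i]) :
  0 <= alpha -> (0 < k)%N -> a k != 0 ->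
  (forall z : R[i], char_roots k a z <->
        exists j : nat, (1 <= j <= k)%N /\ z = lambda j) ->
  (forall j : nat, (1 <= j <= k)%N -> mup (lambda j) (charpoly k a) = 1%N) ->
  (forall j : nat, (1 <= j < k)%N -> Re (lambda j) < Re (lambda j.+1)) ->
  forall y : R[i] -> R[i], is_solution k a y -> nontrivial y ->
   (zero_count y (strip alpha) <=
        ((k.-1)%:R ^+ 2 +
         2 / pi * (k.-1)%:R * shortest_polyline (char_roots k a) *
           (alpha * (Xi k lambda + 2) + Theta k lambda * ln 4))%:E)%E.
Proof.
move=> a0 k0 ak rootsE simple lam_lt y ysol ny; have [s sk sE] := charpoly_factor ak.
pose r := [seq lambda j | j <- iota 1 k].
have sr : size r = k by rewrite size_map size_iota.
have nr (i : nat) : (i < k)%N -> nth 0 r i = lambda i.+1.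
  by move=> ik; rewrite (nth_map 0%N) ?size_iota // nth_iota.
have Hlam := Re_gap lam_lt.
set T := Theta k lambda in Hlam *; set X := Xi k lambda in Hlam *.
have T0 : 0 <= T := bigmax_nat_ge0 _ _.
have X0 : 0 <= X := bigmax_nat_ge0 _ _.
have ur : uniq r.
  apply/(uniqP 0) => i j; rewrite !inE sr => ik jk; rewrite !nr // => E.
  apply: contrapT => /eqP; rewrite neq_ltn => /orP[] h.
    have [] := Hlam i j; first by rewrite h jk.
    by rewrite E subrr mulr0 lern0 subn_eq0 leqNgt h.
  have [] := Hlam j i; first by rewrite h ik.
  by rewrite E subrr mulr0 lern0 subn_eq0 leqNgt h.
have mr z : (z \in r) = (z \in s).
  apply/idP/idP => [/mapP[j]|zs].
    rewrite mem_iota add1n ltnS => jk ->; apply/(char_roots_mem _ ak sE)/rootsE.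
    by exists j.
  have /(char_roots_mem _ ak sE)/rootsE[j [jk ->]] := zs.
  by apply: map_f; rewrite mem_iota add1n ltnS.
have us : uniq s.
  apply: count_mem_uniq => z; have [zs|zs] := boolP (z \in s); last exact: count_memPn.
  have := zs; rewrite -mr => /mapP[j]; rewrite mem_iota add1n ltnS => jk zE.
  have := simple j jk; rewrite -zE sE -mul_polyC mupMr ?mu_prod_XsubC //.
  by rewrite rootC.
have prs : perm_eq r s by apply: uniq_perm.
have path_bound v ps : char_roots k a `<=` polyline v ps ->
    (zero_count y (strip alpha) <= ((k.-1)%:R ^+ 2 + 2 / pi * (k.-1)%:R * polyline_length v ps *
      (alpha * (X + 2) + T * ln 4))%:E)%E.
  move=> Hps; have [|l lr Hl] := @polyline_shortcut R v ps r ur.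
    by move=> z; rewrite mr => /(char_roots_mem _ ak sE); exact: Hps.
  have ls : perm_eq l s := perm_trans lr prs.
  have lk : size l = k by rewrite (perm_size ls).
  case: l lr Hl ls lk => [|b t] lr Hl ls lk; first by rewrite -lk in k0.
  have bE : charpoly k a = a k *: \prod_(z <- b :: t) ('X - z%:P).
    by rewrite sE (perm_big _ ls).
  have anny := solution_annihilated ak lk bE ysol.
  have [|P [HP yE]] := solution_terms ur _ anny.
    by move=> z; rewrite (perm_mem ls) mr.
  have HP' (i : nat) : (i < k)%N -> (size (P i) <= 1)%N.
    move=> ik; rewrite -sr in ik; apply: leq_trans (HP i ik) _.
    by rewrite count_uniq_mem ?leq_b1 // (perm_uniq ls).
  rewrite sr in yE.
  pose S := 2 * alpha * X + 2 * T * ln 3.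
  have ln3 : 0 <= ln 3 :> R by rewrite ln_ge0 //; lra.
  have S0 : 0 <= S by rewrite addr_ge0 // !mulr_ge0.
  have HT i j : (i < j < k)%N -> 0 < T /\ T^-1 * (j - i)%:R <= Re (nth 0 r j) - Re (nth 0 r i) /\
     `|Im (nth 0 r j) - Im (nth 0 r i)| <= X * (Re (nth 0 r j) - Re (nth 0 r i)).
    move=> ijk; have [h1 h2] := Hlam i j ijk; have /andP[ij jk] := ijk.
    have Tp : 0 < T.
      rewrite lt_neqAle T0 andbT; apply/eqP => T1; move: h1.
      by rewrite -T1 mul0r lern0 subn_eq0 leqNgt ij.
    rewrite !nr ?(ltn_trans ij jk) //; split=> //; split=> //.
    by rewrite mulrC ler_pdivrMr // mulrC.
  have H := @zero_count_expsum R alpha T^-1 X 1 S (nth 0 r) P k 0 [::] y b t a0 X0 ltr01 S0 anny ny yE.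
  apply: le_trans (H _ HP' _ _ _ _) _ => //.
  - by move=> i j /HT[].
  - move=> i c ik p0 /rootP; have := HP' i ik; move=> /size1_polyC pC.
    by move: p0; rewrite pC polyC_eq0 hornerC => /negP + /eqP.
  - by move=> _; rewrite lerDl !mulr_ge0.
  - move=> k1 x _; have [Tp _] := HT 0%N 1%N k1.
    rewrite mul0r mulr0 mul0r subr0 mulrC ler_pdivrMr // /S; lra.
  rewrite lee_fin add0n expr2 -/(size t) (_ : size t = k.-1); last by rewrite -lk.
  rewrite mulrDr lerD2l.
  have ln34 : ln 3 <= ln 4 :> R by rewrite ler_ln ?posrE //; lra.
  have L0 := polyline_length_ge0 v ps; have L1 := polyline_length_ge0 b t.
  have Hlb : polyline_length b t <= polyline_length v ps.
    by apply: le_trans Hl; rewrite /= lerDr normc_ge0.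
  have S1 : S + 2 * alpha <= 2 * (alpha * (X + 2) + T * ln 4).
    have := ler_wpM2l T0 ln34; rewrite /S; lra.
  have Sa : 0 <= S + 2 * alpha by rewrite addr_ge0 // mulr_ge0.
  have := ler_pM L1 Sa Hlb S1 => hh.
  have k10 : 0 <= (k.-1)%:R / pi :> R by rewrite divr_ge0 // ltW // pi_gt0.
  have := ler_wpM2l k10 hh; move: (@pi R)^-1 => q; lra.
set c0 := (k.-1)%:R ^+ 2 in path_bound *; set c1 := 2 / pi * _ in path_bound *.
set c2 := alpha * _ + _ in path_bound *.
have c10 : 0 <= c1 by rewrite /c1 mulr_ge0 // divr_ge0 // ltW // pi_gt0.
have c20 : 0 <= c2.
  by rewrite /c2 addr_ge0 // mulr_ge0 // ?addr_ge0 // ln_ge0 //; lra.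
clearbody c0 c1 c2.
have [v [ps rE]] : exists v ps, r = v :: ps.
  by case: (r) sr k0 => [<- //|v ps]; exists v, ps.
have pathr : char_roots k a `<=` polyline v ps.
  by move=> z /(char_roots_mem _ ak sE); rewrite -mr rE; exact: polyline_mem.
have zfin : zero_count y (strip alpha) \is a fin_num.
  rewrite ge0_fin_numE ?zero_count_ge0 //.
  by apply: le_lt_trans (path_bound v ps pathr) _; rewrite ltry.
rewrite -(fineK zfin) lee_fin; set N := fine _.
have NE v' ps' : char_roots k a `<=` polyline v' ps' -> N <= c0 + c1 * polyline_length v' ps' * c2.
  by move=> /path_bound; rewrite -(fineK zfin) lee_fin.
(* Pass to the infimum of the lengths, on which the bound depends linearly. *)
have [c120|c120] := eqVneq (c1 * c2) 0.
  by have := NE v ps pathr; rewrite ![c1 * _ * c2]mulrAC c120 !mul0r.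
have c12 : 0 < c1 * c2 by rewrite lt_neqAle eq_sym c120 mulr_ge0.
rewrite -lerBlDl mulrAC -ler_pdivrMl //; apply: lb_le_inf.
  by exists (polyline_length v ps), v, ps.
move=> _ [v' [ps' [/NE h ->]]]; rewrite ler_pdivrMl //; lra.
Qed.

End Main.

Theorem proposition9 (R : realType) (alpha : R) (k : nat) (a : nat -> R[i])
    (alpha_ge0 : 0 <= alpha)
    (k_gt0 : (0 < k)%N)
    (ak_neq0 : a k <> 0)
    (distinct_Re : forall u v : R[i], char_roots k a u -> char_roots k a v ->
       u <> v -> complex.Re u <> complex.Re v) :
  (exists N : nat, forall y : R[i] -> R[i],
     is_solution k a y -> nontrivial y ->
     (zero_count y (strip alpha) <= (N%:R)%:E)%E)
  /\
  (forall lambda : nat -> R[i],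
     (forall z : R[i], char_roots k a z <->
        exists j : nat, (1 <= j <= k)%N /\ z = lambda j) ->
     (forall j : nat, (1 <= j <= k)%N -> mup (lambda j) (charpoly k a) = 1%N) ->
     (forall j : nat, (1 <= j < k)%N ->
        complex.Re (lambda j) < complex.Re (lambda j.+1)) ->
     forall y : R[i] -> R[i], is_solution k a y -> nontrivial y ->
       (zero_count y (strip alpha) <=
        ((k.-1)%:R ^+ 2 +
         2 / pi * (k.-1)%:R * shortest_polyline (char_roots k a) *
           (alpha * (Xi k lambda + 2) + Theta k lambda * ln 4))%:E)%E).
Proof.
have /eqP ak := ak_neq0.
split; first exact: finite_bound.
by move=> lambda rootsE simple lam_lt; exact: explicit_bound.
Qed.
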